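(* Assume that (H1) holds. Then for any $y_0\in\mathcal{D}$ there exists $\delta>0$ such that, over the time interval $[t_0,t_0+\delta]$, the Maxey--Riley equation $$\ddot y=\frac{R}{2}\frac{D}{Dt}\Big(3u(y,t)+\frac{\gamma}{10}\mu^{-1}\Delta u(y,t)\Big)+\Big(1-\frac{3R}{2}\Big)g-\mu\Big(\dot y-u(y,t)-\frac{\gamma}{6}\mu^{-1}\Delta u(y,t)\Big)-\kappa\mu^{1/2}\Big\{\int_{t_0}^{t}\frac{\dot w(s)}{\sqrt{t-s}}\,ds+\frac{w(t_0)}{\sqrt{t-t_0}}\Big\},$$ where $w(t)=\dot y(t)-u(y(t),t)-\frac{\gamma}{6}\mu^{-1}\Delta u(y(t),t)$, has a unique (strong) solution $y:[t_0,t_0+\delta]\to\mathcal{D}$ satisfying $y(t_0)=y_0$ and $w(t_0)=0$.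
   Context: Let $n\in\{2,3\}$, let $\mathcal{D}\subseteq\mathbb{R}^n$ be open, $\mathbb{R}^+=[0,\infty)$, $t_0\in\mathbb{R}^+$, and let $u:\mathcal{D}\times\mathbb{R}^+\to\mathbb{R}^n$, $u=u(x,t)$, be a fluid velocity field. Let $R=\frac{2\rho_f}{\rho_f+2\rho_p}$, $\mu=R/\mathrm{St}$, $\kappa=\sqrt{9R/(2\pi)}$, $\gamma=\frac{9R}{2\mathrm{Re}}$ be positive constants (with densities $\rho_f,\rho_p>0$ and Stokes and Reynolds numbers $\mathrm{St},\mathrm{Re}>0$), and let $g\in\mathbb{R}^n$ be a constant vector. Here $\Delta$ is the componentwise spatial Laplacian and $\frac{D}{Dt}=\partial_t+u\cdot\nabla$ is the material derivative (computed as a field on $\mathcal{D}\times\mathbb{R}^+$ and then evaluated at $(y(t),t)$). Dots denote time derivatives along the trajectory $y(t)$. Assumption (H1): $u(x,t)$ is three times continuously differentiable in its arguments over $\mathcal{D}\times\mathbb{R}^+$, and its partial derivatives (including mixed partials) are uniformly bounded and Lipschitz continuous up to order three (order zero, i.e. $u$ itself, included). A strong solution is one that is smooth enough to satisfy the differential form of the equation: $y$ and $w$ are continuously differentiable on $[t_0,t_0+\delta]$ (equivalently $y$ is twice continuously differentiable) and the equation holds on $[t_0,t_0+\delta]$. Since $w(t_0)=0$, the term $w(t_0)/\sqrt{t-t_0}$ is absent (read as $0$, also at $t=t_0$). *)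

(* Defs.v *)
From HB Require Import structures.
From mathcomp Require Import all_boot all_order all_algebra.
From mathcomp Require Import all_classical all_reals all_analysis.
Set Implicit Arguments.
Unset Strict Implicit.
Unset Printing Implicit Defensive.
Import Order.TTheory GRing.Theory Num.Theory.
Import numFieldNormedType.Exports.
Local Open Scope classical_set_scope.
Local Open Scope ring_scope.

Section DeriveWithin.
Context {R : realType} {V W : normedModType R}.

(* Same difference quotient as the library's [derivable] and [derive], with the
   increments restricted to those that stay in E. These are one-sided
   derivatives at t = 0 for the flow and at the ends of the time interval for
   the trajectory. *)
Definition derivable_within (E : set V) (f : V -> W) (a v : V) : Prop :=
  cvg ((fun h : R => h^-1 *: (f (h *: v + a) - f a))
         @ within [set h | E (h *: v + a)] 0^').

Definition derive_within (E : set V) (f : V -> W) (a v : V) : W :=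
  lim ((fun h : R => h^-1 *: (f (h *: v + a) - f a))
         @ within [set h | E (h *: v + a)] 0^').

End DeriveWithin.

Section Flow.
Context {R : realType} {n : nat}.
Implicit Types (D : set 'rV[R]_n) (u : 'rV[R]_n * R -> 'rV[R]_n).

Definition spacetime D : set ('rV[R]_n * R) := D `*` `[0, +oo[.

(* [Some i] is the i-th space coordinate and [None] is time. *)
Definition axis (k : option 'I_n) : 'rV[R]_n * R :=
  if k is Some i then (delta_mx 0 i, 0) else (0, 1).

Definition partial D (k : option 'I_n) u : 'rV[R]_n * R -> 'rV[R]_n :=
  fun p => derive_within (spacetime D) u p (axis k).

Definition partials D (s : seq (option 'I_n)) u : 'rV[R]_n * R -> 'rV[R]_n :=
  foldr (partial D) u s.

(* The library norms on 'rV[R]_n and on products are sup norms. They are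
   equivalent to the Euclidean norms, so boundedness and Lipschitz continuity
   have their usual meaning. *)
Definition H1 D u : Prop :=
  (forall s k, (size s < 3)%N -> forall p, spacetime D p ->
     derivable_within (spacetime D) (partials D s u) p (axis k)) /\
  (forall s, (size s <= 3)%N ->
     [/\ {within spacetime D, continuous (partials D s u)},
         [bounded partials D s u p | p in spacetime D] &
         [lipschitz partials D s u p | p in spacetime D]]).

Definition laplacian D u : 'rV[R]_n * R -> 'rV[R]_n :=
  fun p => \sum_(i < n) partials D [:: Some i; Some i] u p.

(* Df/Dt along the flow u. *)
Definition material D u (f : 'rV[R]_n * R -> 'rV[R]_n) :
    'rV[R]_n * R -> 'rV[R]_n :=
  fun p => partial D None f p + \sum_(i < n) u p 0 i *: partial D (Some i) f p.

End Flow.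

Record physics (R : realType) (n : nat) := MkParams {
  rho_f : R;
  rho_p : R;
  stokes : R;
  reynolds : R;
  gravity : 'rV[R]_n
}.

Section MaxeyRiley.
Context {R : realType} {n : nat}.
Context (P : physics R n) (D : set 'rV[R]_n).
Context (u : 'rV[R]_n * R -> 'rV[R]_n).

Definition density_ratio : R := 2 * rho_f P / (rho_f P + 2 * rho_p P).
Definition mu : R := density_ratio / stokes P.
Definition kappa : R := Num.sqrt (9 * density_ratio / (2 * pi)).
Definition gamma : R := 9 * density_ratio / (2 * reynolds P).

Context (t0 delta : R).

(* Time derivative of a curve defined on [t0, t0 + delta]. *)
Definition dot (z : R -> 'rV[R]_n) : R -> 'rV[R]_n :=
  fun t => derive_within `[t0, t0 + delta] z t 1.

Definition C1 (z : R -> 'rV[R]_n) : Prop :=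
  (forall t, t \in `[t0, t0 + delta] ->
     derivable_within `[t0, t0 + delta] z t 1) /\
  {within `[t0, t0 + delta], continuous (dot z)}.

Context (y : R -> 'rV[R]_n).

Definition relvel : R -> 'rV[R]_n := fun t =>
  dot y t - u (y t, t) - (gamma / 6 * mu^-1) *: laplacian D u (y t, t).

(* The integrand is divided by 0, hence equal to 0, at the single point s = t.
   For relvel of class C^1 the integral converges absolutely for every t. *)
Definition memory (t : R) : 'rV[R]_n :=
  \row_i (\int[lebesgue_measure]_(s in `[t0, t])
             (dot relvel s 0 i / Num.sqrt (t - s)))
  + (Num.sqrt (t - t0))^-1 *: relvel t0.

Definition maxey_riley_at (t : R) : Prop :=
  dot (dot y) t =
    (density_ratio / 2) *:
      material D u
        (fun p => 3 *: u p + (gamma / 10 * mu^-1) *: laplacian D u p) (y t, t)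
    + (1 - 3 * density_ratio / 2) *: gravity P
    - mu *: (dot y t - u (y t, t)
             - (gamma / 6 * mu^-1) *: laplacian D u (y t, t))
    - (kappa * Num.sqrt mu) *: memory t.

Definition strong_solution : Prop :=
  [/\ C1 y, C1 (dot y), C1 relvel &
      forall t, t \in `[t0, t0 + delta] -> D (y t) /\ maxey_riley_at t].

End MaxeyRiley.

(* Main.v *)
Require Import Defs.
From HB Require Import structures.
From mathcomp Require Import all_boot all_order all_algebra.
From mathcomp Require Import all_classical all_reals all_analysis.
From mathcomp Require Import measurable_realfun lra ring.
Import Order.TTheory GRing.Theory Num.Theory.
Import numFieldNormedType.Exports.
Local Open Scope classical_set_scope.
Local Open Scope ring_scope.

Set Implicit Arguments.
Unset Strict Implicit.
Unset Printing Implicit Defensive.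

(** Let A = u + (gamma / 6 mu) Lap u be the fluid velocity with its Faxen
correction ([faxen_velocity]), so that the slip is w = y' - A(y, t). Along a
trajectory the chain rule ([is_derive_within_field]) gives
  y'' = w' + dA/dt + sum_i y'_i dA/dx_i,
and inserting y' = w + A into the equation of motion leaves
  w' = G(y, t) - sum_i w_i dA/dx_i - mu w - kappa sqrt(mu) K w',
where G is built from the flow and gravity, and K v (t) is the integral of
v(s) / sqrt(t - s) over [t0, t] ([acceleration_balance]). With q = y' and
v = w' as unknowns, and y and w recovered from them by integration, the
problem becomes a system of integral equations for a pair of continuous
functions, in which nothing is differentiated ([solution_system],
[system_solution]). Derivatives of u of order three occur in it, through G and
dA/dx_i, and (H1) makes all its coefficients bounded and Lipschitz
([smooth_flow_blend]).

The kernel of K is singular but integrable, with integral 2 sqrt(t - t0)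
([Rintegral_abel_kernel]). On an interval of length s^2 the right-hand sides
therefore depend on (q, v) in a Lipschitz way with a constant of order s
([rhs_contraction]), and for small s Picard iteration ([picard_fixed_point])
produces a solution whose slip stays below 1 and whose trajectory stays in a
ball inside the domain ([volterra_system]).

Uniqueness holds on the same interval and among all solutions, however large
they are. The only product of unknowns is w_i dA/dx_i(y, t); in the difference
of two solutions the increment of dA/dx_i can be paired with the slip of either
of them. Paired with the slip of the constructed solution, it yields the
contraction estimate against an arbitrary competitor.

Time derivatives at the ends of the interval, and those of the flow at time 0,
are one-sided. They are handled through the first-order estimate
[is_derive_within] and a mean value inequality proved by a supremum argument
([mean_value_within]); curves given on a segment are extended to the line by
constants ([clamp]). *)

(** * The weakly singular kernel *)

Section AbelKernel.
Context {R : realType}.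
Notation leb := (@lebesgue_measure R).

Lemma segment_bounded (W : normedModType R) (f : R -> W) (a b : R) :
  continuous f -> exists E, forall t, a <= t <= b -> `|f t| <= E.
Proof.
move=> cf.
have /compact_bounded[M [_ mrt]] : compact (f @` `[a, b]).
  by apply: continuous_compact; [exact: continuous_subspaceT|exact: segment_compact].
exists (M + 1) => t tab; apply: mrt; first by rewrite ltrDl.
by exists t => //; rewrite /= in_itv.
Qed.

Lemma continuous_integrable (f : R -> R) (a b : R) :
  continuous f -> leb.-integrable `[a, b] (EFin \o f).
Proof.
move=> cf; apply: continuous_compact_integrable; first exact: segment_compact.
exact: continuous_subspaceT.
Qed.

Lemma Rintegral_segment_cst (a b r : R) : a <= b ->
  \int[leb]_(x in `[a, b]) r = r * (b - a).
Proof.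
move=> ab; rewrite Rintegral_cst//= lebesgue_measure_itv/= lte_fin.
case: ltP => [//|ba].
have -> : a = b by apply/eqP; rewrite eq_le ab.
by rewrite subrr.
Qed.

Definition abel_kernel (c s : R) : R := (Num.sqrt (c - s))^-1.

Lemma abel_kernel_ge0 c s : 0 <= abel_kernel c s.
Proof. by rewrite invr_ge0 sqrtr_ge0. Qed.

Lemma continuous_abel_kernel c s : s < c -> {for s, continuous (abel_kernel c)}.
Proof.
move=> sc; apply: continuousV; first by rewrite gt_eqF// sqrtr_gt0 subr_gt0.
apply: continuous_comp; last exact: sqrt_continuous.
by apply: continuousB; [exact: cst_continuous|].
Qed.

Lemma is_derive_sqrt_sub (c s : R) : s < c ->
  is_derive s 1 (fun x => - 2 * Num.sqrt (c - x)) (abel_kernel c s).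
Proof.
move=> sc; have cs : 0 < c - s by rewrite subr_gt0.
have H := is_derive1_sqrt cs.
have H2 : is_derive s 1 (fun x => c - x) (- 1 : R).
  have := @is_deriveB R R R (cst c) id s 1 0 1 (is_derive_cst _ _ _) (is_derive_id _ _).
  by rewrite sub0r.
have H3 := @is_derive1_comp _ Num.sqrt (fun x => c - x) s _ _ H H2.
have := @is_deriveZ R R R _ (-2) s 1 _ H3.
congr (is_derive _ _ _ _); rewrite /abel_kernel invfM /GRing.scale /=.
by rewrite mulrN1 mulrNN mulrA divff ?mul1r.
Qed.

Lemma continuous_sqrt_sub (c : R) :
  continuous (fun x : R => - 2 * Num.sqrt (c - x)).
Proof.
move=> x.
apply: (@continuousM R R (cst (-2)) (fun x => Num.sqrt (c - x))).
  exact: cst_continuous.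
apply: (@continuous_comp _ _ _ (fun x => c - x) Num.sqrt).
  by apply: (@continuousB _ R R (cst c) id); [exact: cst_continuous|exact: cvg_id].
exact: sqrt_continuous.
Qed.

(** On c - s >= 0 the kernel is the power of c - s with exponent -1/2, also at
s = c where both are 0, and powers are measurable on the whole line. *)
Lemma measurable_abel_kernel (c : R) (A : set R) : measurable A ->
  A `<=` `]-oo, c] -> measurable_fun A (abel_kernel c).
Proof.
move=> mA Ac.
have H : {in A, (fun s => (c - s) `^ (- 2^-1)) =1 abel_kernel c}.
  move=> s /set_mem/Ac; rewrite /= in_itv/= => sc.
  by rewrite powRN powR12_sqrt// subr_ge0.
apply: (eq_measurable_fun _ H) => //.
apply: (@measurableT_comp _ _ _ _ _ _ (@powR R ^~ (- 2^-1))) => //.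
by apply: measurable_funB => //; exact: measurable_cst.
Qed.

Lemma bigcup_itv_left (a c : R) : a < c ->
  \bigcup_k `[a, c - (c - a) / k.+1%:R]%classic = `[a, c[%classic.
Proof.
move=> ac; apply/seteqP; split=> [x [k _]|x]; rewrite /= !in_itv/=.
  move=> /andP[-> xk]/=; apply: le_lt_trans xk _.
  by rewrite ltrBlDr ltrDl divr_gt0// subr_gt0.
move=> /andP[ax xc].
have cx : 0 < c - x by rewrite subr_gt0.
exists (Num.truncn ((c - a) / (c - x))) => //=; rewrite in_itv/= ax/=.
rewrite lerBrDr -lerBrDl ler_pdivrMr// -ler_pdivrMl// mulrC.
exact/ltW/truncnS_gt.
Qed.

Lemma integral_abel_kernel_lt (a b c : R) : a <= b -> b < c ->
  (\int[leb]_(s in `[a, b]) (abel_kernel c s)%:E =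
   (2 * (Num.sqrt (c - a) - Num.sqrt (c - b)))%:E)%E.
Proof.
rewrite le_eqVlt => /predU1P[-> _|ab bc].
  by rewrite set_itv1 integral_set1 subrr mulr0.
rewrite (@continuous_FTC2 _ _ (fun x => - 2 * Num.sqrt (c - x)))//=.
- by rewrite -EFinB; congr EFin; ring.
- by apply: continuous_in_subspaceT => x /set_mem; rewrite /= in_itv/= => /andP[_ xb];
    apply: continuous_abel_kernel; exact: le_lt_trans bc.
- split.
  + move=> x; rewrite in_itv/= => /andP[_ xb].
    by have [] := is_derive_sqrt_sub (lt_trans xb bc).
  + exact/cvg_at_right_filter/continuous_sqrt_sub.
  + exact/cvg_at_left_filter/continuous_sqrt_sub.
- move=> x; rewrite in_itv/= => /andP[_ xb]; rewrite derive1E.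
  by have [_] := is_derive_sqrt_sub (lt_trans xb bc).
Qed.

Lemma cvg_abel_left (a c : R) : a < c ->
  2 * (Num.sqrt (c - a) - Num.sqrt (c - (c - (c - a) / k.+1%:R))) @[k --> \oo]
    --> 2 * Num.sqrt (c - a).
Proof.
move=> ac.
have H : (c - (c - (c - a) / k.+1%:R)) @[k --> \oo] --> 0.
  have -> : (fun k : nat => c - (c - (c - a) / k.+1%:R)) =
      (fun k => (c - a) * k.+1%:R^-1).
    by apply/funext => k; rewrite subKr.
  rewrite -[X in _ --> X](mulr0 (c - a)); apply: cvgMl_tmp; exact: cvg_harmonic.
have H2 : Num.sqrt (c - (c - (c - a) / k.+1%:R)) @[k --> \oo] --> Num.sqrt (0 : R).
  by apply: (cvg_comp _ _ H); exact: sqrt_continuous.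
rewrite sqrtr0 in H2.
rewrite -[in X in _ --> X](subr0 (Num.sqrt (c - a))).
by apply: cvgMl_tmp; apply: cvgB H2; exact: cvg_cst.
Qed.

(** The primitive -2 sqrt(c - s) has no derivative at c, so the improper
integral is reached by monotone convergence along segments that stop before
c. *)
Lemma integral_abel_kernel (a c : R) : a < c ->
  (\int[leb]_(s in `[a, c]) (abel_kernel c s)%:E = (2 * Num.sqrt (c - a))%:E)%E.
Proof.
move=> ac; rewrite -integral_itv_bndo_bndc; last first.
  apply/measurable_EFinP; apply: measurable_abel_kernel => //.
  by move=> x; rewrite /= !in_itv/= => /andP[_ /ltW].
rewrite -(bigcup_itv_left ac).
have lec k : c - (c - a) / k.+1%:R < c by rewrite ltrBlDr ltrDl divr_gt0// subr_gt0.
have lea k : a <= c - (c - a) / k.+1%:R.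
  by rewrite lerBrDr -lerBrDl ler_pdivrMr// ler_peMr ?subr_ge0 ?ler1n// ltW.
pose J k := (\int[leb]_(x in `[a, (c - (c - a) / k.+1%:R)%R]) (abel_kernel c x)%:E)%E.
apply: (@cvg_unique _ (@ereal_hausdorff R) (fmap J \oo)).
  apply: ge0_nondecreasing_set_cvg_integral.
  - move=> m k mk; apply/subsetPset => x; rewrite /= !in_itv/= => /andP[-> xm]/=.
    apply: le_trans xm _; rewrite lerD2l lerN2 ler_pM2l ?subr_gt0//.
    by rewrite lef_pV2 ?posrE// ler_nat.
  - by move=> k; exact: measurable_itv.
  - move=> k; apply/measurable_EFinP; apply: measurable_abel_kernel => //.
    by move=> x; rewrite /= !in_itv/= => /andP[_ xk]; exact: le_trans (ltW (lec k)).
  - by move=> k x _; rewrite lee_fin abel_kernel_ge0.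
have -> : J = EFin \o (fun k : nat =>
    2 * (Num.sqrt (c - a) - Num.sqrt (c - (c - (c - a) / k.+1%:R)))).
  by apply/funext => k /=; rewrite /J integral_abel_kernel_lt.
apply: cvg_EFin; last exact: cvg_abel_left.
by apply: nearW.
Qed.

(** The singularity of the kernel costs half a power of the length: the integral
is of order sqrt(c - a). This is what makes the memory term small on short
intervals. *)
Lemma Rintegral_abel_kernel (a b c : R) : a <= b -> b <= c ->
  leb.-integrable `[a, b] (EFin \o abel_kernel c) /\
  \int[leb]_(s in `[a, b]) abel_kernel c s = 2 * (Num.sqrt (c - a) - Num.sqrt (c - b)).
Proof.
move=> ab bc.
suff H : (\int[leb]_(s in `[a, b]) (abel_kernel c s)%:E =
   (2 * (Num.sqrt (c - a) - Num.sqrt (c - b)))%:E)%E.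
  split; last by rewrite /Rintegral H.
  apply/integrableP; split.
    apply/measurable_EFinP; apply: measurable_abel_kernel => //.
    by move=> x; rewrite /= !in_itv/= => /andP[_ xb]; exact: le_trans bc.
  under eq_integral => x _ do rewrite /= ger0_norm ?abel_kernel_ge0//.
  by rewrite H ltry.
move: bc; rewrite le_eqVlt => /predU1P[<-|bc]; last exact: integral_abel_kernel_lt.
rewrite subrr sqrtr0 subr0.
move: ab; rewrite le_eqVlt => /predU1P[->|ab]; last exact: integral_abel_kernel.
by rewrite set_itv1 integral_set1 subrr sqrtr0 mulr0.
Qed.

Lemma integrable_mul_abel (f : R -> R) (a b c : R) : continuous f -> a <= b ->
  b <= c -> leb.-integrable `[a, b] (EFin \o (fun s => f s / Num.sqrt (c - s))).
Proof.
move=> cf ab bc; have [iab _] := Rintegral_abel_kernel ab bc.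
apply: (@integrableMr _ _ _ leb _ (measurable_itv _) f _ _ _ iab).
  by case/integrableP: (continuous_integrable a b cf) => /measurable_EFinP.
have [M fM] := segment_bounded a b cf.
exists M; split; first exact: num_real.
move=> y My x; rewrite /= in_itv/= => xab.
exact: le_trans (fM x xab) (ltW My).
Qed.

(** The comparison is asked on the half-open interval because kernels with
different singularities are ordered only there: at its own singularity the
kernel takes the value 0, below every kernel that is singular later. *)
Lemma Rintegral_ler_norm (f g : R -> R) (a b : R) :
  leb.-integrable `[a, b] (EFin \o f) -> leb.-integrable `[a, b] (EFin \o g) ->
  (forall s, a <= s < b -> `|f s| <= g s) ->
  `|\int[leb]_(s in `[a, b]) f s| <= \int[leb]_(s in `[a, b]) g s.
Proof.
move=> fi gi fg.
have sub : `[a, b[ `<=` `[a, b].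
  by move=> x; rewrite /= !in_itv/= => /andP[-> /ltW].
have fi' : leb.-integrable `[a, b[ (EFin \o f) by exact: integrableS fi.
have gi' : leb.-integrable `[a, b[ (EFin \o g) by exact: integrableS gi.
rewrite -!Rintegral_itv_bndo_bndc//.
apply: le_trans (le_normr_Rintegral _ fi') _ => //.
apply: le_Rintegral => //; first exact: (integrable_abse fi').
Qed.

Lemma Rintegral_segment_le (f : R -> R) (a b e : R) : continuous f -> a <= b ->
  (forall s, a <= s <= b -> `|f s| <= e) ->
  `|\int[leb]_(s in `[a, b]) f s| <= e * (b - a).
Proof.
move=> cf ab fe; rewrite -Rintegral_segment_cst//.
apply: Rintegral_ler_norm => [||s /andP[sa sb]].
- exact: continuous_integrable.
- by apply: continuous_integrable => x; exact: cvg_cst.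
- by apply: fe; rewrite sa ltW.
Qed.

Lemma Rintegral_abel_kernel_le (f : R -> R) (a b c e : R) : continuous f ->
  a <= b -> b <= c -> (forall s, a <= s <= b -> `|f s| <= e) ->
  `|\int[leb]_(s in `[a, b]) (f s / Num.sqrt (c - s))|
     <= e * (2 * (Num.sqrt (c - a) - Num.sqrt (c - b))).
Proof.
move=> cf ab bc fe; have [iab <-] := Rintegral_abel_kernel ab bc.
rewrite -RintegralZl//; apply: Rintegral_ler_norm => [||s /andP[sa sb]].
- exact: integrable_mul_abel.
- exact: (@integrableZl _ _ _ _ _ _ e _ iab).
- rewrite normrM (ger0_norm (abel_kernel_ge0 _ _)) ler_wpM2r ?abel_kernel_ge0//.
  by apply: fe; rewrite sa ltW.
Qed.

Lemma Rintegral_split (f : R -> R) (a s t : R) :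
  leb.-integrable `[a, t] (EFin \o f) -> a <= s <= t ->
  \int[leb]_(x in `[a, t]) f x =
  \int[leb]_(x in `[a, s]) f x + \int[leb]_(x in `[s, t]) f x.
Proof.
move=> fi /andP[sa st].
have := @Rintegral_itvB R f (BLeft a) (BRight t) s fi.
rewrite !bnd_simp => /(_ sa st)/eqP; rewrite subr_eq addrC => /eqP ->; congr (_ + _).
rewrite Rintegral_itv_obnd_cbnd//; apply: integrableS fi => //.
by move=> x; rewrite /= !in_itv/= => /andP[sx ->]; rewrite (le_trans sa (ltW sx)).
Qed.

(** Dependence on the endpoint of order one half. The part over [t, t'] is at
most e times the integral of its kernel. Over [a, t] the kernel singular at t
dominates the one singular at t', so the integral of the absolute difference
is a difference of two known integrals. Each part contributes
2 e sqrt(t' - t). *)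
Lemma abel_diff_le (f : R -> R) (a t t' e : R) : continuous f ->
  a <= t <= t' -> (forall s, a <= s <= t' -> `|f s| <= e) ->
  `|\int[leb]_(s in `[a, t']) (f s / Num.sqrt (t' - s)) -
    \int[leb]_(s in `[a, t]) (f s / Num.sqrt (t - s))| <= e * (4 * Num.sqrt (t' - t)).
Proof.
move=> cf /andP[sa st] fe.
have e0 : 0 <= e by apply: le_trans (fe a _); rewrite ?lexx ?(le_trans sa).
have fa' : forall s, a <= s <= t -> `|f s| <= e.
  by move=> s /andP[as_ st']; apply: fe; rewrite as_ (le_trans st').
have i1 := integrable_mul_abel cf sa st.
have i2 := integrable_mul_abel cf sa (lexx t).
have [j1 J1] := Rintegral_abel_kernel sa st.
have [j2 J2] := Rintegral_abel_kernel sa (lexx t).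
rewrite (@Rintegral_split _ a t t') ?sa//; last first.
  exact: (integrable_mul_abel cf (le_trans sa st)).
rewrite addrAC -RintegralB//.
have -> : e * (4 * Num.sqrt (t' - t)) =
    e * (2 * Num.sqrt (t' - t)) + e * (2 * Num.sqrt (t' - t)) by ring.
apply: le_trans (ler_normD _ _) _; apply: lerD; last first.
  apply: le_trans (Rintegral_abel_kernel_le cf st (lexx t') _) _.
    by move=> s /andP[ts st']; apply: fe; rewrite st' (le_trans sa).
  by rewrite subrr sqrtr0 subr0.
have j3 : leb.-integrable `[a, t]
    (EFin \o (fun s => abel_kernel t s - abel_kernel t' s)).
  exact: (@integrableB _ _ _ leb _ _ _ _ j2 j1).
have H : `|\int[leb]_(s in `[a, t])
      (f s / Num.sqrt (t' - s) - f s / Num.sqrt (t - s))| <=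
  \int[leb]_(s in `[a, t]) (e * (abel_kernel t s - abel_kernel t' s)).
  apply: Rintegral_ler_norm => [||s /andP[as_ sb]].
  - exact: (@integrableB _ _ _ leb _ _ _ _ i1 i2).
  - by apply: (integrableZl _ e j3).
  - rewrite -mulrBr normrM distrC; apply: ler_pM => //.
      by apply: fa'; rewrite as_ ltW.
    rewrite ger0_norm// subr_ge0 lef_pV2 ?posrE ?sqrtr_gt0 ?subr_gt0//.
      by apply: ler_wsqrtr; rewrite lerD2r.
    exact: lt_le_trans st.
apply: le_trans H _; rewrite RintegralZl//.
rewrite RintegralB// J1 J2 ler_wpM2l// subrr sqrtr0 subr0 -mulrBr ler_pM2l//.
have H : Num.sqrt (t - a) <= Num.sqrt (t' - a) by apply: ler_wsqrtr; rewrite lerD2r.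
lra.
Qed.

End AbelKernel.

(** * Integrals of vector-valued curves *)

Section VectorIntegral.
Context {R : realType} {n : nat}.
Notation leb := (@lebesgue_measure R).
Implicit Types (f g : R -> 'rV[R]_n) (x : 'rV[R]_n).

Lemma rV_norm_leP x (e : R) : 0 <= e ->
  reflect (forall i, `|x 0 i| <= e) (`|x| <= e).
Proof.
move=> e0; rewrite [`|x|]/Num.Def.normr/= mx_normrE.
apply: (iffP (bigmax_leP _ _ _ _)) => [[_ H] i|H]; first exact: (H (0, i)).
by split=> // -[i j] _ /=; rewrite ord1.
Qed.

Lemma rV_coord_le x i : `|x 0 i| <= `|x|.
Proof. by have/rV_norm_leP := lexx `|x|; apply. Qed.

Lemma continuous_coord f i : continuous f -> continuous (fun s => f s 0 i : R).
Proof.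
move=> cf s.
by apply: (@continuous_comp _ _ _ f (fun M : 'rV[R]_n => M 0 i));
  [exact: cf|exact: coord_continuous].
Qed.

Definition primitive f (a t : R) : 'rV[R]_n :=
  \row_i \int[leb]_(s in `[a, t]) f s 0 i.

(** Up to the factor 1 / sqrt(pi), the Riemann-Liouville integral of order one
half. *)
Definition abel_integral f (a t : R) : 'rV[R]_n :=
  \row_i \int[leb]_(s in `[a, t]) (f s 0 i / Num.sqrt (t - s)).

Lemma eq_primitive f g a t : (forall s, a <= s <= t -> f s = g s) ->
  primitive f a t = primitive g a t.
Proof.
move=> fg; apply/rowP => i; rewrite !mxE; apply: eq_Rintegral => s /set_mem.
by rewrite /= in_itv/= => /fg ->.
Qed.

Lemma eq_abel_integral f g a t : (forall s, a <= s <= t -> f s = g s) ->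
  abel_integral f a t = abel_integral g a t.
Proof.
move=> fg; apply/rowP => i; rewrite !mxE; apply: eq_Rintegral => s /set_mem.
by rewrite /= in_itv/= => /fg ->.
Qed.

Lemma primitivexx f a : primitive f a a = 0.
Proof. by apply/rowP => i; rewrite !mxE set_itv1 Rintegral_set1. Qed.

Lemma primitive_cst x a t : a <= t -> primitive (fun=> x) a t = (t - a) *: x.
Proof.
by move=> at_; apply/rowP => i; rewrite !mxE Rintegral_segment_cst// mulrC.
Qed.

Lemma primitiveB f g a t : continuous f -> continuous g ->
  primitive (fun s => f s - g s) a t = primitive f a t - primitive g a t.
Proof.
move=> cf cg; apply/rowP => i; rewrite !mxE -RintegralB//.
- by apply: eq_Rintegral => s _; rewrite !mxE.
- by apply: continuous_integrable; exact: continuous_coord.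
- by apply: continuous_integrable; exact: continuous_coord.
Qed.

Lemma abel_integralB f g a t : continuous f -> continuous g -> a <= t ->
  abel_integral (fun s => f s - g s) a t = abel_integral f a t - abel_integral g a t.
Proof.
move=> cf cg at_; apply/rowP => i; rewrite !mxE -RintegralB//.
- by apply: eq_Rintegral => s _; rewrite !mxE mulrBl.
- by apply: integrable_mul_abel => //; exact: continuous_coord.
- by apply: integrable_mul_abel => //; exact: continuous_coord.
Qed.

Lemma primitive_split f a s t : continuous f -> a <= s <= t ->
  primitive f a t = primitive f a s + primitive f s t.
Proof.
move=> cf ast; apply/rowP => i; rewrite !mxE; apply: Rintegral_split => //.
by apply: continuous_integrable; exact: continuous_coord.
Qed.

Lemma norm_primitive_le f a t e : continuous f -> a <= t ->
  (forall s, a <= s <= t -> `|f s| <= e) -> `|primitive f a t| <= e * (t - a).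
Proof.
move=> cf at_ fe.
have e0 : 0 <= e by apply: le_trans (fe a _) => //; rewrite lexx.
apply/rV_norm_leP; first by rewrite mulr_ge0// subr_ge0.
move=> i; rewrite mxE; apply: Rintegral_segment_le => //.
  exact: continuous_coord.
by move=> s /fe; apply: le_trans; exact: rV_coord_le.
Qed.

Lemma norm_abel_integral_le f a t e : continuous f -> a <= t ->
  (forall s, a <= s <= t -> `|f s| <= e) ->
  `|abel_integral f a t| <= e * (2 * Num.sqrt (t - a)).
Proof.
move=> cf at_ fe.
have e0 : 0 <= e by apply: le_trans (fe a _) => //; rewrite lexx.
apply/rV_norm_leP; first by rewrite !mulr_ge0// sqrtr_ge0.
move=> i; rewrite mxE.
have := @Rintegral_abel_kernel_le R _ a t t e
  (continuous_coord (i := i) cf) at_ (lexx t).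
rewrite subrr sqrtr0 subr0; apply => s /fe.
by apply: le_trans; exact: rV_coord_le.
Qed.

Lemma abel_integral_holder f a t t' e : continuous f -> a <= t <= t' ->
  (forall s, a <= s <= t' -> `|f s| <= e) ->
  `|abel_integral f a t' - abel_integral f a t| <= e * (4 * Num.sqrt (t' - t)).
Proof.
move=> cf att fe.
have e0 : 0 <= e.
  case/andP: att => at_ tt; apply: le_trans (fe a _) => //.
  by rewrite lexx (le_trans at_).
apply/rV_norm_leP; first by rewrite !mulr_ge0// sqrtr_ge0.
move=> i; rewrite !mxE; apply: abel_diff_le => //; first exact: continuous_coord.
by move=> s /fe; apply: le_trans; exact: rV_coord_le.
Qed.

End VectorIntegral.

(** * Derivatives along a set *)

Section WithinDerivative.
Context {R : realType} {V W : normedModType R}.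
Implicit Types (E : set V) (f g : V -> W) (a v : V) (l : W).

(** The difference quotient cleared of its denominator. In this form h = 0 is
harmless, and sums, restrictions and compositions are plain estimates. *)
Definition is_derive_within E f a v l : Prop := forall e : R, 0 < e ->
  exists2 d : R, 0 < d & forall h : R, `|h| < d -> E (h *: v + a) ->
    `|f (h *: v + a) - f a - h *: l| <= e * `|h|.

(** If E gave no increments to test, every vector would be a derivative: this is
the condition for uniqueness. *)
Definition accessible E a v : Prop := forall d : R, 0 < d ->
  exists h : R, [/\ h != 0, `|h| < d & E (h *: v + a)].

Lemma is_derive_withinP E f a v l : is_derive_within E f a v l <->
  (fun h : R => h^-1 *: (f (h *: v + a) - f a))
    @ within [set h | E (h *: v + a)] 0^' --> l.
Proof.
have quot (h : R) : h != 0 -> `|l - h^-1 *: (f (h *: v + a) - f a)| * `|h| =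
    `|f (h *: v + a) - f a - h *: l|.
  move=> h0; rewrite mulrC -normrZ scalerBr scalerA divff// scale1r.
  by rewrite -normrN opprB.
split=> H.
  apply/cvgrPdist_le => e e0; have [d d0 {}H] := H e e0.
  exists d => //= h /=; rewrite sub0r normrN => hd h0 Eh.
  have hp : 0 < `|h| by rewrite normr_gt0.
  by rewrite -(ler_pM2r hp) quot// H.
move=> e e0; move/cvgrPdist_le : H => /(_ e e0)[d d0 H]; exists d => // h hd Eh.
have [->|h0] := eqVneq h 0.
  by rewrite !scale0r add0r subrr subr0 !normr0 mulr0.
rewrite -quot// ler_wpM2r//; apply: H => //.
by rewrite /ball_/= sub0r normrN.
Qed.

Lemma accessible_proper E a v : accessible E a v ->
  ProperFilter (within [set h : R | E (h *: v + a)] 0^').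
Proof.
move=> acc; apply: Build_ProperFilter_ex => P [d d0 H].
have [h [h0 hd Eh]] := acc d d0.
by exists h; apply: H => //=; rewrite sub0r normrN.
Qed.

Lemma derivable_is_derive_within E f a v : derivable_within E f a v ->
  is_derive_within E f a v (derive_within E f a v).
Proof. by move=> H; apply/is_derive_withinP. Qed.

Lemma is_derive_within_derivable E f a v l :
  is_derive_within E f a v l -> derivable_within E f a v.
Proof. by move=> /is_derive_withinP H; apply/cvg_ex; exists l. Qed.

Lemma is_derive_within_val E f a v l : accessible E a v ->
  is_derive_within E f a v l -> derive_within E f a v = l.
Proof.
move=> acc /is_derive_withinP H; have pf := accessible_proper acc.
exact: cvg_lim.
Qed.

Lemma eq_is_derive_within E f g a v l : E a -> (forall p, E p -> f p = g p) ->
  is_derive_within E f a v l -> is_derive_within E g a v l.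
Proof.
move=> Ea fg H e e0; have [d d0 {}H] := H e e0; exists d => // h hd Eh.
by rewrite -!fg// H.
Qed.

Lemma is_derive_within_cst E a v (c : W) : is_derive_within E (fun=> c) a v 0.
Proof.
move=> e e0; exists 1 => // h _ _; rewrite subrr scaler0 subr0 normr0.
by rewrite mulr_ge0// ltW.
Qed.

Lemma is_derive_withinD E f g a v l m :
  is_derive_within E f a v l -> is_derive_within E g a v m ->
  is_derive_within E (fun p => f p + g p) a v (l + m).
Proof.
move=> Hf Hg e e0; have e20 : 0 < e / 2 by rewrite divr_gt0.
have [d d0 {}Hf] := Hf _ e20; have [d' d'0 {}Hg] := Hg _ e20.
exists (Num.min d d'); first by rewrite lt_min d0.
move=> h; rewrite lt_min => /andP[hd hd'] Eh.
have -> : f (h *: v + a) + g (h *: v + a) - (f a + g a) - h *: (l + m) =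
  (f (h *: v + a) - f a - h *: l) + (g (h *: v + a) - g a - h *: m).
  by rewrite scalerDr !opprD [X in X + _ = _]addrACA [LHS]addrACA.
rewrite (le_trans (ler_normD _ _))// (splitr e) mulrDl.
by rewrite lerD ?Hf ?Hg.
Qed.

Lemma is_derive_withinZ E f a v l (k : R) : is_derive_within E f a v l ->
  is_derive_within E (fun p => k *: f p) a v (k *: l).
Proof.
move=> Hf e e0; have k0 : 0 < `|k| + 1 by rewrite ltr_wpDl.
have [d d0 {}Hf] := Hf (e / (`|k| + 1)) (divr_gt0 e0 k0).
exists d => // h hd Eh.
rewrite -scalerBr scalerA mulrC -scalerA -scalerBr normrZ.
apply: le_trans (ler_wpM2l _ (Hf h hd Eh)) _ => //.
rewrite mulrA ler_wpM2r// mulrCA ler_piMr// ?(ltW e0)//.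
by rewrite ler_pdivrMr// mul1r lerDl.
Qed.

Lemma is_derive_within_sum E (I : Type) (r : seq I) (F : I -> V -> W)
    (L : I -> W) a v :
  (forall i, is_derive_within E (F i) a v (L i)) ->
  is_derive_within E (fun p => \sum_(i <- r) F i p) a v (\sum_(i <- r) L i).
Proof.
move=> H; elim: r => [|i r IH].
  under eq_fun do rewrite big_nil; rewrite big_nil.
  exact: (is_derive_within_cst _ _ _ 0).
under eq_fun do rewrite big_cons; rewrite big_cons.
exact: (is_derive_withinD (f := F i) (g := fun p => \sum_(j <- r) F j p)).
Qed.

End WithinDerivative.

(** * Curves on a segment *)

Section Curves.
Context {R : realType} {W : normedModType R}.
Implicit Types (a b t : R).

Lemma accessible_segment a b t : a < b -> a <= t <= b ->
  accessible `[a, b] t (1 : R).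
Proof.
move=> ab /andP[at_ tb] d d0.
have [tb'|bt] := ltP t b.
  pose m := Num.min (d / 2) (b - t).
  have m0 : 0 < m by rewrite lt_min divr_gt0//= subr_gt0.
  have md : m <= d / 2 by rewrite ge_min lexx.
  have mb : m <= b - t by rewrite ge_min lexx orbT.
  exists m; split; first by rewrite gt_eqF.
    by rewrite gtr0_norm//; lra.
  by rewrite /= in_itv/= /GRing.scale/= mulr1; apply/andP; split; lra.
pose m := Num.min (d / 2) (b - a).
have m0 : 0 < m by rewrite lt_min divr_gt0//= subr_gt0.
have md : m <= d / 2 by rewrite ge_min lexx.
have mb : m <= b - a by rewrite ge_min lexx orbT.
exists (- m); split; first by rewrite oppr_eq0 gt_eqF.
  by rewrite normrN gtr0_norm//; lra.
by rewrite /= in_itv/= /GRing.scale/= mulr1; apply/andP; split; lra.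
Qed.

(** A supremum argument, which treats vector values and one-sided derivatives at
the ends uniformly. The s with |f s - f a| <= (C + e) (s - a) have a supremum c
that satisfies the same inequality, and the derivative at c carries the
inequality beyond c unless c = b. *)
Lemma mean_value_within (f l : R -> W) a b C : a <= b ->
  (forall s, a <= s <= b -> is_derive_within `[a, b] f s 1 (l s)) ->
  (forall s, a <= s <= b -> `|l s| <= C) -> `|f b - f a| <= C * (b - a).
Proof.
move=> ab fl lC; apply/ler_addgt0Pr => e0 e00.
have [e e0' eE] : exists2 e, 0 < e & e * (b - a) <= e0.
  exists (e0 / (b - a + 1)); first by rewrite divr_gt0// ltr_wpDl// subr_ge0.
  rewrite mulrAC ler_pdivrMr ?ltr_wpDl ?subr_ge0//.
  by rewrite ler_pM2l// lerDl.
suff : `|f b - f a| <= (C + e) * (b - a).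
  by move/le_trans; apply; rewrite mulrDl lerD2l.
pose S := [set s | a <= s <= b /\ `|f s - f a| <= (C + e) * (s - a)].
have Sa : S a by split; rewrite ?lexx// !subrr normr0 mulr0.
have hS : has_sup S by split; [exists a|exists b => x [/andP[]]].
pose c := sup S.
have ac : a <= c by exact: ub_le_sup hS.2 _ Sa.
have cb : c <= b by apply: ge_sup; [exists a|move=> x [/andP[]]].
have cab : a <= c <= b by rewrite ac.
have [d d0 H] := fl c cab e e0'.
have {}H s : a <= s <= b -> `|s - c| < d -> `|f s - f c| <= (C + e) * `|s - c|.
  move=> sab sc; have := H (s - c) sc; rewrite /= in_itv/=.
  have -> : (s - c) *: (1 : R) + c = s by rewrite /GRing.scale/= mulr1 subrK.
  move=> /(_ sab) Hs; rewrite -[f s - f c](subrK ((s - c) *: l c)).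
  rewrite (le_trans (ler_normD _ _))// mulrDl addrC lerD// normrZ mulrC.
  by rewrite ler_wpM2r// lC.
have Ce : 0 <= C + e by rewrite addr_ge0 ?(ltW e0')//; exact: le_trans (lC _ cab).
have Sc : S c.
  split=> //; have [s Ss sc] := sup_adherent d0 hS.
  have sc' : s <= c by exact: ub_le_sup hS.2 _ Ss.
  have [sab Hs] := Ss.
  have ds : `|s - c| < d by rewrite distrC ger0_norm ?subr_ge0// ltrBlDr -ltrBlDl.
  have := H s sab ds; rewrite distrC (distrC s).
  rewrite (ger0_norm (_ : 0 <= c - s)) ?subr_ge0// => H2.
  rewrite -[f c](subrK (f s)) -addrA (le_trans (ler_normD _ _))//.
  rewrite (le_trans (lerD H2 Hs))// -mulrDr.
  by rewrite ler_wpM2l// addrA subrK.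
have [cb'|bc] := ltP c b; last first.
  by have <- : c = b; [apply/eqP; rewrite eq_le cb|case: Sc].
pose s := Num.min (c + d / 2) b.
have cs : c < s by rewrite lt_min cb' ltrDl divr_gt0.
suff /(ub_le_sup hS.2) : S s by rewrite leNgt cs.
have sab : a <= s <= b by rewrite (le_trans ac (ltW cs))/= ge_min lexx orbT.
split=> //; have := H s sab; rewrite gtr0_norm ?subr_gt0// => H2.
have {}H2 : `|f s - f c| <= (C + e) * (s - c).
  apply: H2; rewrite ltrBlDl gt_min ltrD2l ltr_pdivrMr// ltr_pMr// ltr1n.
  by [].
case: Sc => _ Hc; rewrite -[f s](subrK (f c)) -addrA (le_trans (ler_normD _ _))//.
rewrite (le_trans (lerD H2 Hc))// -mulrDr.
by rewrite ler_wpM2l// addrA subrK.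
Qed.

(** Composed with [clamp], a curve given on a segment becomes a continuous curve
on the whole line, constant outside the segment; integrals and uniform limits
then concern plain continuous functions. *)
Definition clamp a b t : R := Num.max a (Num.min b t).

Lemma clampP a b t : a <= b -> a <= clamp a b t <= b.
Proof. by move=> ab; rewrite le_max lexx/= ge_max ab ge_min lexx. Qed.

Lemma clamp_id a b t : a <= t <= b -> clamp a b t = t.
Proof. by move=> /andP[at_ tb]; rewrite /clamp (min_idPr tb) (max_idPr at_). Qed.

Lemma clamp_lip a b s t : `|clamp a b s - clamp a b t| <= `|s - t|.
Proof.
have := ler_norm (s - t); have := ler_norm (t - s); rewrite distrC => ? ?.
rewrite /clamp ler_norml; case: (leP b s) => ?; case: (leP b t) => ?;
  case: (leP a b) => ?; case: (leP a s) => ?; case: (leP a t) => ?;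
  apply/andP; split; lra.
Qed.

Lemma continuous_clamp a b : continuous (clamp a b).
Proof.
move=> t; apply/cvgrPdist_le => e e0; exists e => //= s /= ts.
exact: le_trans (clamp_lip _ _ _ _) (ltW ts).
Qed.

Lemma within_continuous_clamp (f : R -> W) a b : a <= b ->
  {within `[a, b], continuous f} -> continuous (f \o clamp a b).
Proof.
move=> ab /subspace_continuousP cf t.
apply: (@cvg_trans _ (f x @[x --> within `[a, b] (nbhs (clamp a b t))]));
  last first.
  by apply: cf; rewrite /= in_itv/= clampP.
move=> P [d d0 H].
have /cvgrPdist_lt/(_ d d0)[e e0 He] := @continuous_clamp a b t.
exists e => //= s /He/H; apply; rewrite /= in_itv/= clampP//.
Qed.

Lemma eq_within_continuous (f g : R -> W) a b : continuous g ->
  (forall t, a <= t <= b -> f t = g t) -> {within `[a, b], continuous f}.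
Proof.
move=> cg fg; apply: (@subspace_eq_continuous _ _ _ g).
  by move=> t /set_mem; rewrite /= in_itv/= => /fg.
exact: continuous_subspaceT.
Qed.

End Curves.

(** * Primitives as curves *)

Section PrimitiveCurves.
Context {R : realType} {n : nat}.
Implicit Types (f g z l : R -> 'rV[R]_n) (a b t : R).

Lemma is_derive_within_primitive f a b t : continuous f -> a <= t <= b ->
  is_derive_within `[a, b] (primitive f a) t 1 (f t).
Proof.
move=> cf /andP[at_ tb] e e0.
have /cvgrPdist_le/(_ e e0)[d d0 H] := cf t.
have key s s' : a <= s <= s' -> (forall r, s <= r <= s' -> `|t - r| < d) ->
    `|primitive f s s' - (s' - s) *: f t| <= e * (s' - s).
  move=> /andP[as_ ss] sd; have cft : continuous (fun _ : R => f t) by exact: cst_continuous.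
  rewrite -(primitive_cst (f t) ss) -(@primitiveB _ _ f (fun=> f t) s s' cf cft).
  apply: norm_primitive_le => // [x|r rs].
    by apply: cvgB; [exact: cf|exact: cvg_cst].
  by rewrite distrC; apply: H; exact: sd.
exists d => // h hd; rewrite /= in_itv/= /GRing.scale/= mulr1 => /andP[ah hb].
have [h0|/ltW h0] := leP 0 h.
  rewrite (@primitive_split _ _ f a t (h + t))// ?at_ ?lerDr//.
  rewrite [primitive f a t + _]addrC addrK.
  have := key t (h + t); rewrite addrK (ger0_norm h0); apply.
    by rewrite at_ lerDr.
  move=> r /andP[tr rh]; rewrite distrC ger0_norm ?subr_ge0//.
  by rewrite ger0_norm// in hd; lra.
rewrite (@primitive_split _ _ f a (h + t) t)// ?ah ?gerDr//.
rewrite opprD addrA subrr sub0r.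
have := key (h + t) t; rewrite opprD addrCA subrr addr0 (ler0_norm h0).
rewrite scaleNr opprK -[X in _ -> X <= _]normrN opprD !opprK; apply.
  by rewrite ah gerDr.
move=> r /andP[hr rt]; rewrite ger0_norm ?subr_ge0//.
by rewrite ler0_norm// in hd; lra.
Qed.

(** The difference of z and the primitive has derivative 0, so the mean value
inequality makes it constant. *)
Lemma is_derive_within_primitive_eq z l a b : a <= b -> continuous l ->
  (forall t, a <= t <= b -> is_derive_within `[a, b] z t 1 (l t)) ->
  forall t, a <= t <= b -> z t = z a + primitive l a t.
Proof.
move=> ab cl zl t /andP[at_ tb].
apply/eqP; rewrite -subr_eq0 -normr_le0.
have H s : a <= s <= t ->
    is_derive_within `[a, t] (fun r => z r + (-1) *: primitive l a r) s 1
      (l s + (-1) *: l s).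
  move=> /andP[as_ st]; apply: is_derive_withinD.
    move=> e e0; have [|d d0 H] := zl s _ e e0; first by rewrite as_ (le_trans st).
    exists d => // h hd; rewrite /= in_itv/= => /andP[ah ht].
    by apply: H => //; rewrite /= in_itv/= ah (le_trans ht).
  apply: is_derive_withinZ; apply: is_derive_within_primitive => //; by rewrite as_.
have := mean_value_within at_ H (C := 0).
rewrite mul0r primitivexx scaler0 addr0 !scaleN1r opprD addrA addrAC; apply.
by move=> s _; rewrite scaleN1r subrr normr0.
Qed.

End PrimitiveCurves.

Section Moduli.
Context {R : realType} {U W : normedModType R}.

Lemma lip_continuous (g : U -> W) (C : R) :
  (forall s t, `|g s - g t| <= C * `|s - t|) -> continuous g.
Proof.
move=> H t; apply/cvgrPdist_le => e e0.
have C0 : 0 < `|C| + 1 by rewrite ltr_wpDl.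
apply/nbhs_ballP; exists (e / (`|C| + 1)) => /=; first exact: divr_gt0.
move=> s; rewrite -ball_normE /= ltr_pdivlMr// => ts; apply: le_trans (H _ _) _.
apply: le_trans (ltW ts); rewrite mulrC ler_wpM2l//.
by rewrite (le_trans (ler_norm _))// lerDl.
Qed.

Lemma holder_continuous (g : R -> W) (C : R) :
  (forall s t, `|g s - g t| <= C * Num.sqrt `|s - t|) -> continuous g.
Proof.
move=> H t; apply/cvgrPdist_le => e e0.
have C0 : 0 < `|C| + 1 by rewrite ltr_wpDl.
have q0 : 0 < e / (`|C| + 1) by exact: divr_gt0.
exists ((e / (`|C| + 1)) ^+ 2) => /=; first exact: exprn_gt0.
move=> s /= ts; apply: le_trans (H _ _) _.
have : Num.sqrt `|t - s| <= e / (`|C| + 1).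
  rewrite -(ger0_norm (ltW q0)) -(sqrtr_sqr (e / _)); apply: ler_wsqrtr; exact: ltW.
rewrite ler_pdivlMr// => {}ts; apply: le_trans ts; rewrite mulrC ler_wpM2l ?sqrtr_ge0//.
by rewrite (le_trans (ler_norm _))// lerDl.
Qed.

End Moduli.

Section ClampedPrimitives.
Context {R : realType} {n : nat}.
Implicit Types (f : R -> 'rV[R]_n) (a b : R).

(** [clamp] is 1-Lipschitz, so a modulus of continuity on the segment survives
the extension. *)
Lemma clamp_modulus (W : normedModType R) (g : R -> W) (w : R -> R) a b : a <= b ->
  (forall x y, 0 <= x -> x <= y -> w x <= w y) ->
  (forall s t, a <= s <= t -> t <= b -> `|g t - g s| <= w (t - s)) ->
  forall s t, `|g (clamp a b s) - g (clamp a b t)| <= w `|s - t|.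
Proof.
move=> ab wm H s t.
wlog st : s t / clamp a b s <= clamp a b t => [Hw|].
  have [/Hw//|/ltW/Hw] := leP (clamp a b s) (clamp a b t).
  by rewrite distrC [in leRHS]distrC.
have /andP[as_ sb] := clampP s ab; have /andP[at_ tb] := clampP t ab.
rewrite distrC; apply: le_trans (H _ _ _ tb) _; first by rewrite as_.
apply: wm; first by rewrite subr_ge0.
by apply: le_trans (clamp_lip a b s t); rewrite distrC ler_norm.
Qed.

Lemma continuous_primitive_clamp f a b e : a <= b -> continuous f ->
  (forall s, a <= s <= b -> `|f s| <= e) ->
  continuous (fun t => primitive f a (clamp a b t)).
Proof.
move=> ab cf fe; apply: (@lip_continuous _ _ _ _ e).
have e0 : 0 <= e by apply: le_trans (fe a _) => //; rewrite lexx.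
apply: (@clamp_modulus _ (primitive f a) (fun x => e * x)) => //.
  by move=> x y _ xy; exact: ler_wpM2l.
move=> s t /andP[as_ st] tb.
rewrite (@primitive_split _ _ f a s t) ?as_// addrAC subrr add0r.
apply: norm_primitive_le => // r /andP[sr rt]; apply: fe.
by rewrite (le_trans as_ sr) (le_trans rt tb).
Qed.

Lemma continuous_abel_integral_clamp f a b e : a <= b -> continuous f ->
  (forall s, a <= s <= b -> `|f s| <= e) ->
  continuous (fun t => abel_integral f a (clamp a b t)).
Proof.
move=> ab cf fe; apply: (@holder_continuous _ _ _ (e * 4)).
have e0 : 0 <= e by apply: le_trans (fe a _) => //; rewrite lexx.
apply: (@clamp_modulus _ (abel_integral f a) (fun x => e * 4 * Num.sqrt x)) => //.
  by move=> x y _ xy; rewrite ler_wpM2l ?mulr_ge0// ler_wsqrtr.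
move=> s t /andP[as_ st] tb; rewrite -mulrA.
apply: abel_integral_holder => //; first by rewrite as_.
by move=> r /andP[ar rt]; apply: fe; rewrite ar (le_trans rt).
Qed.

End ClampedPrimitives.

(** * The chain rule for fields on spacetime *)

Section Fields.
Context {R : realType} {n : nat} (D : set 'rV[R]_n).
Implicit Types (F G : 'rV[R]_n * R -> 'rV[R]_n) (p q : 'rV[R]_n * R).
Implicit Types (x y : 'rV[R]_n) (k : option 'I_n).

(** A single constant serves for the bound and for the Lipschitz estimate, so
that finitely many fields can share it. *)
Definition bdlip_by (M : R) F : Prop :=
  (forall p, spacetime D p -> `|F p| <= M) /\
  (forall p q, spacetime D p -> spacetime D q -> `|F p - F q| <= M * `|p - q|).

Definition bdlip F : Prop := exists2 M : R, 0 <= M & bdlip_by M F.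

(** The level of regularity that (H1) leaves to the Laplacian of u, whose first
partial derivatives are of order three in u. *)
Definition smooth_field F : Prop :=
  [/\ forall k p, spacetime D p -> derivable_within (spacetime D) F p (axis k),
      bdlip F & forall k, bdlip (partial D k F)].

Lemma pair_norm_le (p : 'rV[R]_n * R) (e : R) :
  (`|p| <= e) = (`|p.1| <= e) && (`|p.2| <= e).
Proof. by rewrite prod_normE /= ge_max. Qed.

Lemma axis_space (h : R) (i : 'I_n) p :
  h *: axis (Some i) + p = (h *: delta_mx 0 i + p.1, p.2).
Proof.
case: p => x t; rewrite [LHS]surjective_pairing; congr pair.
by rewrite /= scaler0 add0r.
Qed.

Lemma axis_time (h : R) p : h *: axis None + p = (p.1, h + p.2).
Proof.
case: p => x t; rewrite [LHS]surjective_pairing; congr pair; rewrite /=.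
  by rewrite scaler0 add0r.
by rewrite /GRing.scale/= mulr1.
Qed.

Lemma norm_delta_le (h : R) (i : 'I_n) : `|h *: (delta_mx 0 i : 'rV[R]_n)| <= `|h|.
Proof.
apply/rV_norm_leP => // j; rewrite !mxE normrM ler_piMr//.
by case: (_ && _); rewrite ?normr1 ?normr0.
Qed.

Lemma open_radius x : open D -> D x ->
  exists2 r : R, 0 < r & forall y, `|y - x| < r -> D y.
Proof.
move=> oD Dx; have /nbhs_ballP[r r0 H] : nbhs x D by exact: open_nbhs_nbhs.
exists r => // y yx; apply: H; rewrite -ball_normE /=.
by rewrite distrC.
Qed.

Lemma accessible_spacetime p k : open D -> spacetime D p ->
  accessible (spacetime D) p (axis k).
Proof.
case: p => x t oD [/= Dx]; rewrite in_itv/= andbT => t0 d d0.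
case: k => [i|]; last first.
  exists (d / 2); have d20 : 0 < d / 2 by rewrite divr_gt0.
  split; first by rewrite gt_eqF.
    by rewrite gtr0_norm//; lra.
  rewrite axis_time; split => //=; rewrite in_itv/= andbT.
  exact: addr_ge0 (ltW d20) t0.
have [r r0 H] := open_radius oD Dx.
pose m := Num.min (d / 2) (r / 2).
have m0 : 0 < m by rewrite lt_min !divr_gt0.
have md : m <= d / 2 by rewrite ge_min lexx.
have mr : m <= r / 2 by rewrite ge_min lexx orbT.
exists m; split; first by rewrite gt_eqF.
  by rewrite gtr0_norm//; lra.
rewrite axis_space; split => /=; last by rewrite in_itv/= andbT.
apply: H; rewrite addrK; apply: le_lt_trans (norm_delta_le _ _) _.
by rewrite gtr0_norm//; lra.
Qed.

Lemma is_derive_within_partial F k p : spacetime D p ->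
  (forall q, spacetime D q -> derivable_within (spacetime D) F q (axis k)) ->
  is_derive_within (spacetime D) F p (axis k) (partial D k F p).
Proof. by move=> sp H; apply: derivable_is_derive_within; exact: H. Qed.

(** The mean value inequality for F minus its linear model along one axis. The
sign of h is free, hence the two orders of 0 and h. *)
Lemma axis_increment F k p (h C : R) (l : 'rV[R]_n) :
  (forall q, spacetime D q -> derivable_within (spacetime D) F q (axis k)) ->
  (forall s : R, (0 <= s <= h) || (h <= s <= 0) ->
     spacetime D (s *: axis k + p) /\
     `|partial D k F (s *: axis k + p) - l| <= C) ->
  `|F (h *: axis k + p) - F p - h *: l| <= C * `|h|.
Proof.
move=> dF H.
pose phi s := F (s *: axis k + p) + (-1) *: (s *: l).
have dphi a b : (forall s, a <= s <= b -> (0 <= s <= h) || (h <= s <= 0)) ->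
    forall s, a <= s <= b ->
    is_derive_within `[a, b] phi s 1 (partial D k F (s *: axis k + p) + (-1) *: l).
  move=> ab s sab; apply: is_derive_withinD; last first.
    apply: is_derive_withinZ => e e0; exists 1 => // r _ _.
    rewrite /GRing.scale/= mulr1 -/(GRing.scale _ _) scalerDl addrK subrr normr0.
    by rewrite mulr_ge0// ltW.
  move=> e e0; have [d d0 H2] := is_derive_within_partial (H s (ab s sab)).1 dF e0.
  exists d => // r rd rE.
  have rs : (r *: (1 : R) + s) *: axis k + p = r *: axis k + (s *: axis k + p).
    by rewrite /GRing.scale/= mulr1 -/(GRing.scale _ _) scalerDl addrA.
  rewrite rs; apply: H2 => //; rewrite -rs.
  by apply: (H _ (ab _ _)).1; move: rE; rewrite /= in_itv.
have phi0 : phi 0 = F p by rewrite /phi !scale0r scaler0 add0r addr0.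
have phih : phi h = F (h *: axis k + p) - h *: l by rewrite /phi scaleN1r.
have -> : F (h *: axis k + p) - F p - h *: l = phi h - phi 0.
  by rewrite phi0 phih addrAC.
have [h0|/ltW h0] := leP 0 h.
  have hab s : 0 <= s <= h -> (0 <= s <= h) || (h <= s <= 0) by move=> ->.
  have := mean_value_within h0 (dphi _ _ hab) (C := C).
  rewrite subr0 (ger0_norm h0); apply => s /hab/H[_].
  by rewrite scaleN1r.
have hab s : h <= s <= 0 -> (0 <= s <= h) || (h <= s <= 0) by move=> ->; rewrite orbT.
have := mean_value_within h0 (dphi _ _ hab) (C := C).
rewrite sub0r (ler0_norm h0) distrC; apply => s /hab/H[_].
by rewrite scaleN1r.
Qed.

(** Points on the way from y to y' when the coordinates are changed one after
the other. For the sup norm they are no farther from y than y' is, so they stay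
in any ball around y that contains y'. *)
Definition hybrid y y' (j : nat) : 'rV[R]_n :=
  \row_i (if (i < j)%N then y' 0 i else y 0 i).

Lemma hybrid0 y y' : hybrid y y' 0 = y.
Proof. by apply/rowP => i; rewrite mxE. Qed.

Lemma hybridn y y' : hybrid y y' n = y'.
Proof. by apply/rowP => i; rewrite mxE ltn_ord. Qed.

Lemma hybridS y y' (j : 'I_n) :
  hybrid y y' j.+1 = (y' 0 j - y 0 j) *: delta_mx 0 j + hybrid y y' j.
Proof.
apply/rowP => i; rewrite !mxE /= ltnS leq_eqVlt -val_eqE /=.
have [ij|ij] := eqVneq (i : nat) j => /=.
  have -> : i = j by exact: val_inj.
  by rewrite ltnn mulr1 subrK.
by rewrite mulr0 add0r.
Qed.

(** The derivative of F in the spacetime direction (v, 1); for v = u p it is the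
material derivative. *)
Definition derive_along F (v : 'rV[R]_n) p : 'rV[R]_n :=
  partial D None F p + \sum_(i < n) v 0 i *: partial D (Some i) F p.

(** From (y, t) to (y', t') one moves along the n space axes and then along the
time axis. On the way each partial derivative stays within L e of its value at
(y, t), so each of the n + 1 moves, of length at most e, costs L e^2. *)
Lemma taylor_field F y y' (t t' r L e : R) :
  (forall k p, spacetime D p -> derivable_within (spacetime D) F p (axis k)) ->
  0 <= L ->
  (forall k, bdlip_by L (partial D k F)) ->
  (forall x, `|x - y| < r -> D x) -> `|y' - y| < r -> 0 <= t -> 0 <= t' ->
  `|y' - y| <= e -> `|t' - t| <= e ->
  `|F (y', t') - F (y, t) - ((t' - t) *: partial D None F (y, t) +
     \sum_(i < n) (y' - y) 0 i *: partial D (Some i) F (y, t))|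
  <= (n.+1)%:R * L * e ^+ 2.
Proof.
move=> dF L0 LF Dr yr t0 t0' ey et.
have e0 : 0 <= e by exact: le_trans (normr_ge0 _) ey.
have inD x (s : R) : `|x - y| <= `|y' - y| -> 0 <= s -> spacetime D (x, s).
  move=> xy s0; split => /=; last by rewrite in_itv/= andbT.
  by apply: Dr; exact: le_lt_trans yr.
have inD0 : spacetime D (y, t) by apply: inD => //; rewrite subrr normr0.
have space (j : 'I_n) : `|F (hybrid y y' j.+1, t) - F (hybrid y y' j, t) -
    (y' - y) 0 j *: partial D (Some j) F (y, t)| <= L * e ^+ 2.
  have -> : (hybrid y y' j.+1, t) =
      (y' 0 j - y 0 j) *: axis (Some j) + (hybrid y y' j, t).
    by rewrite axis_space -hybridS.
  have -> : (y' - y) 0 j = y' 0 j - y 0 j by rewrite !mxE.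
  apply: le_trans (axis_increment (C := L * e) (dF _) _) _; last first.
    rewrite expr2 mulrA ler_wpM2l ?mulr_ge0//.
    apply: le_trans ey; apply: le_trans (rV_coord_le _ j).
    by rewrite !mxE.
  move=> s sh.
  have xs : `|(s *: delta_mx 0 j + hybrid y y' j) - y| <= `|y' - y|.
    apply/rV_norm_leP => // i; rewrite !mxE /= -val_eqE /=.
    have Hi := rV_coord_le (y' - y) i; rewrite !mxE in Hi.
    have [ij|ij] := eqVneq (i : nat) j => /=.
      have -> : i = j by exact: val_inj.
      rewrite ltnn mulr1 addrK.
      have Hj := rV_coord_le (y' - y) j; rewrite !mxE in Hj.
      apply: le_trans Hj; case/orP: sh => /andP[s0 s1].
        by rewrite !ger0_norm//; exact: le_trans s1.
      by rewrite !ler0_norm ?lerN2//; exact: le_trans s1.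
    rewrite mulr0 add0r; case: ifP => // _.
    by rewrite subrr normr0.
  rewrite axis_space /=; have sj := inD _ t xs t0; split => //.
  apply: le_trans ((LF _).2 _ _ sj inD0) _; rewrite ler_wpM2l//.
  rewrite pair_norm_le/= subrr normr0 e0 andbT.
  exact: le_trans ey.
have time : `|F (y', t') - F (y', t) - (t' - t) *: partial D None F (y, t)|
    <= L * e ^+ 2.
  have -> : (y', t') = (t' - t) *: axis None + (y', t) by rewrite axis_time/= subrK.
  apply: le_trans (axis_increment (C := L * e) (dF _) _) _; last first.
    by rewrite expr2 mulrA ler_wpM2l ?mulr_ge0.
  move=> s sh; rewrite axis_time /=.
  have st0 : 0 <= s + t by case/orP: sh => /andP[s0 s1]; lra.
  have sj := inD y' _ (lexx _) st0; split => //.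
  apply: le_trans ((LF _).2 _ _ sj inD0) _; rewrite ler_wpM2l//.
  rewrite pair_norm_le/= ey/= addrK.
  apply: le_trans et; case/orP: sh => /andP[s0 s1].
    by rewrite !ger0_norm//; exact: le_trans s1.
  by rewrite !ler0_norm ?lerN2//; exact: le_trans s1.
have -> : F (y', t') - F (y, t) - ((t' - t) *: partial D None F (y, t) +
     \sum_(i < n) (y' - y) 0 i *: partial D (Some i) F (y, t)) =
   (F (y', t') - F (y', t) - (t' - t) *: partial D None F (y, t)) +
   \sum_(j < n) (F (hybrid y y' j.+1, t) - F (hybrid y y' j, t) -
    (y' - y) 0 j *: partial D (Some j) F (y, t)).
  rewrite big_split/= sumrN.
  have := @telescope_sumr _ 0 n (fun j => F (hybrid y y' j, t)) (leq0n _).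
  rewrite big_mkord hybridn hybrid0 => ->.
  by rewrite [RHS]addrACA -opprD; congr (_ - _); rewrite addrA subrK.
apply: le_trans (ler_normD _ _) _.
have -> : n.+1%:R * L * e ^+ 2 = L * e ^+ 2 + n%:R * (L * e ^+ 2).
  by rewrite -natr1; ring.
rewrite lerD//.
apply: le_trans (ler_norm_sum _ _ _) _.
apply: le_trans (ler_sum _ (fun j _ => space j)) _.
by rewrite sumr_const card_ord mulr_natl.
Qed.

Lemma bdlip_by_le (M N : R) F : M <= N -> bdlip_by M F -> bdlip_by N F.
Proof.
move=> MN [bF lF]; split=> [p sp|p q sp sq]; first exact: le_trans (bF p sp) MN.
by apply: le_trans (lF p q sp sq) _; exact: ler_wpM2r.
Qed.

Lemma bdlip_family (I : finType) (F : I -> 'rV[R]_n * R -> 'rV[R]_n) :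
  (forall i, bdlip (F i)) ->
  exists2 M : R, 0 <= M & forall i, bdlip_by M (F i).
Proof.
move=> bF; pose m i := s2val (cid2 (bF i)).
have m0 i : 0 <= m i by rewrite /m; case: (cid2 (bF i)).
exists (\sum_i m i) => [|i]; first exact: sumr_ge0.
apply: (@bdlip_by_le (m i)); first by rewrite (bigD1 i)//= lerDl sumr_ge0.
by rewrite /m; case: (cid2 (bF i)).
Qed.

(** The quadratic remainder of [taylor_field] disappears for small increments;
what is left is the first-order defect of z, multiplied by bounded partial
derivatives. *)
Lemma is_derive_within_field F (z : R -> 'rV[R]_n) (a b t : R) (v : 'rV[R]_n) :
  open D -> smooth_field F -> 0 <= a -> a <= t <= b ->
  (forall s, a <= s <= b -> D (z s)) ->
  is_derive_within `[a, b] z t 1 v ->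
  is_derive_within `[a, b] (fun s => F (z s, s)) t 1 (derive_along F v (z t, t)).
Proof.
move=> oD [dF _ BF] a0 tab Dz dz e e0.
have [r r0 Dr] := open_radius oD (Dz _ tab).
have [M M0 LF] := bdlip_family BF.
(* w bounds the speed of z near t, c is the resulting Taylor constant, and eta
   is the tolerance on z that the n partial derivatives turn into e / 2. *)
pose w := `|v| + 1.
have w0 : 0 < w by rewrite ltr_wpDl.
pose c := n.+1%:R * M * w ^+ 2.
have c0 : 0 <= c by apply: mulr_ge0; [exact: mulr_ge0|exact: sqr_ge0].
pose nM := n%:R * M.
have nM0 : 0 <= nM by rewrite mulr_ge0.
pose eta := Num.min 1 (e / 2 / (nM + 1)).
have nM1 : 0 < nM + 1 by rewrite ltr_wpDl.
have eta0 : 0 < eta by rewrite lt_min ltr01 !divr_gt0.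
have eta1 : eta <= 1 by rewrite ge_min lexx.
have etaM : nM * eta <= e / 2.
  have : eta <= e / 2 / (nM + 1) by rewrite ge_min lexx orbT.
  by rewrite ler_pdivlMr//; lra.
have [d1 d10 Hz] := dz eta eta0.
have c1 : 0 < c + 1 by rewrite ltr_wpDl.
pose d := Num.min d1 (Num.min (r / w) (e / 2 / (c + 1))).
exists d; first by rewrite !lt_min d10 !divr_gt0.
move=> h; rewrite !lt_min => /and3P[hd1 hr he] hE.
have hab : a <= h *: (1 : R) + t <= b by move: hE; rewrite /= in_itv.
have {}Hz := Hz h hd1 hE.
set t' := h *: (1 : R) + t in hab hE Hz *.
have tt : t' - t = h by rewrite /t' addrK /GRing.scale/= mulr1.
have zw : `|z t' - z t| <= w * `|h|.
  rewrite -[z t' - z t](subrK (h *: v)) (le_trans (ler_normD _ _))//.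
  rewrite /w addrC mulrDl lerD//; first by rewrite normrZ mulrC.
  by apply: le_trans Hz _; rewrite ler_wpM2r.
have t0 : 0 <= t by case/andP: tab => at_ _; exact: le_trans at_.
have t'0 : 0 <= t' by case/andP: hab => at_ _; exact: le_trans at_.
have hr' : `|z t' - z t| < r.
  by apply: le_lt_trans zw _; rewrite mulrC -ltr_pdivlMr.
have hw : `|t' - t| <= w * `|h| by rewrite tt ler_peMl// /w lerDr.
have T := taylor_field dF M0 LF Dr hr' t0 t'0 zw hw.
have -> : F (z t', t') - F (z t, t) - h *: derive_along F v (z t, t) =
   (F (z t', t') - F (z t, t) - ((t' - t) *: partial D None F (z t, t) +
     \sum_(i < n) (z t' - z t) 0 i *: partial D (Some i) F (z t, t))) +
   \sum_(i < n) (z t' - z t - h *: v) 0 i *: partial D (Some i) F (z t, t).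
  rewrite tt /derive_along scalerDr scaler_sumr.
  rewrite -[RHS]addrA; congr (_ + _); rewrite !opprD -addrA; congr (_ + _).
  rewrite -!sumrN -big_split/=; apply: eq_bigr => i _.
  rewrite scalerA -!scaleNr -scalerDl; congr (_ *: _).
  by rewrite !mxE /GRing.scale/=; ring.
apply: le_trans (ler_normD _ _) _; rewrite (splitr e) mulrDl lerD//.
  apply: le_trans T _; rewrite exprMn mulrA -/c.
  rewrite expr2 mulrA ler_wpM2r//.
  by move: he; rewrite ltr_pdivlMr//; have := normr_ge0 h; lra.
apply: le_trans (ler_norm_sum _ _ _) _.
apply: (@le_trans _ _ (\sum_(i < n) eta * `|h| * M)).
  apply: ler_sum => i _; rewrite normrZ; apply: ler_pM => //; last first.
    by apply: (LF _).1; split => /=; [exact: Dz|rewrite in_itv/= andbT].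
  exact: le_trans (rV_coord_le _ _) Hz.
rewrite sumr_const card_ord -[leLHS]mulr_natl.
have -> : n%:R * (eta * `|h| * M) = nM * eta * `|h| by rewrite /nM; ring.
by rewrite ler_wpM2r.
Qed.

End Fields.

(** * Picard iteration *)

Section GeometricComplete.
Context {R : realType}.

(** Completeness in the form in which Picard iteration uses it. It passes from
the reals to row vectors and to products coordinate by coordinate. *)
Definition geometrically_complete (W : normedModType R) : Prop :=
  forall (u : nat -> W) (c : R),
    (forall k, `|u k.+1 - u k| <= c * 2^-1 ^+ k) ->
    exists l, forall k, `|u k - l| <= 2 * c * 2^-1 ^+ k.

Lemma le_geometric_le0 (x c : R) : (forall k, x <= c * 2^-1 ^+ k) -> x <= 0.
Proof.
move=> H; rewrite leNgt; apply/negP => x0.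
pose k := (Num.truncn (c / x)).+1.
have := H k; rewrite exprVn ler_pdivlMr ?exprn_gt0//; apply/negP; rewrite -ltNge.
rewrite mulrC -ltr_pdivrMr//.
apply: lt_le_trans (truncnS_gt _) _.
by rewrite -natrX ler_nat ltnW// ltn_expl.
Qed.

(** The segments of radius 2 c / 2^k around u k are nested, and the supremum of
their left ends belongs to all of them. *)
Lemma real_geometrically_complete : geometrically_complete R.
Proof.
move=> u c H.
have c0 : 0 <= c by have := H 0%N; rewrite expr0 mulr1; exact: le_trans.
have q0 k : 0 <= (2^-1 : R) ^+ k by rewrite exprn_ge0.
pose lo k := u k - 2 * c * 2^-1 ^+ k; pose hi k := u k + 2 * c * 2^-1 ^+ k.
have loS k : lo k <= lo k.+1.
  have := H k; rewrite ler_norml /lo exprS => /andP[? ?].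
  by have := q0 k; nra.
have hiS k : hi k.+1 <= hi k.
  have := H k; rewrite ler_norml /hi exprS => /andP[? ?].
  by have := q0 k; nra.
have lo_mono j k : (j <= k)%N -> lo j <= lo k.
  move=> jk; apply: (@homo_leq _ lo (fun x y => x <= y)) => // y x z.
  exact: le_trans.
have hi_mono j k : (j <= k)%N -> hi k <= hi j.
  move=> jk; apply: (@homo_leq _ hi (fun x y => y <= x)) => // y x z h1 h2.
  exact: le_trans h1.
have lohi j k : lo j <= hi k.
  apply: (le_trans (lo_mono j (maxn j k) (leq_maxl _ _))).
  apply: le_trans (hi_mono k (maxn j k) (leq_maxr _ _)).
  rewrite /lo /hi lerD2l; apply: (@le_trans _ _ 0).
    by rewrite oppr_le0 !mulr_ge0.
  by rewrite !mulr_ge0.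
pose S := range lo.
have hS : has_sup S by split; [exists (lo 0%N), 0%N|exists (hi 0%N) => _ [j _ <-]].
exists (sup S) => k; rewrite ler_norml.
have : lo k <= sup S by apply: ub_le_sup hS.2 _ _; exists k.
have : sup S <= hi k by apply: ge_sup; [exact: hS.1|move=> _ [j _ <-]].
by rewrite /lo /hi => ? ?; apply/andP; split; lra.
Qed.

Lemma rV_geometrically_complete n : geometrically_complete 'rV[R]_n.
Proof.
move=> u c H.
have c0 : 0 <= c by have := H 0%N; rewrite expr0 mulr1; exact: le_trans.
have /choice[l Hl] i :
    exists x : R, forall k, `|u k 0 i - x| <= 2 * c * 2^-1 ^+ k.
  apply: real_geometrically_complete => k; apply: le_trans (H k).
  by have := rV_coord_le (u k.+1 - u k) i; rewrite !mxE.
exists (\row_i l i) => k; apply/rV_norm_leP; first by rewrite !mulr_ge0// exprn_ge0.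
by move=> i; rewrite !mxE.
Qed.

Lemma pair_geometrically_complete (U V : normedModType R) :
  geometrically_complete U -> geometrically_complete V ->
  geometrically_complete (U * V)%type.
Proof.
move=> cU cV u c H.
have [k|x Hx] := cU (fst \o u) c.
  by apply: le_trans (H k); rewrite prod_normE le_max lexx.
have [k|y Hy] := cV (snd \o u) c.
  by apply: le_trans (H k); rewrite prod_normE le_max lexx orbT.
by exists (x, y) => k; rewrite prod_normE ge_max Hx Hy.
Qed.

Lemma uniform_geometric_continuous (W : normedModType R) (u : nat -> R -> W)
    (f : R -> W) (c : R) : (forall k, continuous (u k)) ->
  (forall k t, `|u k t - f t| <= c * 2^-1 ^+ k) -> continuous f.
Proof.
move=> cu uf t; apply/cvgrPdist_le => e e0.
have e30 : 0 < e / 3 by rewrite divr_gt0.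
have [k ke] : exists k, c * 2^-1 ^+ k <= e / 3.
  apply/not_existsP => H; have := @le_geometric_le0 (e / 3) c.
  rewrite leNgt e30 => /(_ _)/negP; apply => // k.
  by have := H k => /negP; rewrite -ltNge => /ltW.
have /cvgrPdist_le/(_ _ e30)[d d0 Hd] := cu k t.
exists d => // s /Hd /= ts.
have -> : f t - f s = - (u k t - f t) + (u k t - u k s) + (u k s - f s).
  by rewrite opprB !addrA !subrK.
rewrite (le_trans (ler_normD _ _))//.
have := ler_normD (- (u k t - f t)) (u k t - u k s); rewrite normrN.
have := uf k t; have := uf k s; lra.
Qed.

(** The iteration starts from 0 and never leaves the functions bounded by V, so
the contraction is asked only between such functions. *)
Theorem picard_fixed_point (W : normedModType R) (V : R)
    (T : (R -> W) -> R -> W) :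
  geometrically_complete W ->
  0 <= V ->
  (forall f, continuous f -> (forall t, `|f t| <= V) ->
     continuous (T f) /\ forall t, `|T f t| <= V) ->
  (forall f g e, continuous f -> (forall t, `|f t| <= V) ->
     continuous g -> (forall t, `|g t| <= V) ->
     (forall t, `|f t - g t| <= e) -> forall t, `|T f t - T g t| <= e / 2) ->
  exists f, [/\ continuous f, forall t, `|f t| <= V & forall t, T f t = f t].
Proof.
move=> cW V0 TP TC.
pose u k := iter k T (fun=> 0).
have uP k : continuous (u k) /\ forall t, `|u k t| <= V.
  elim: k => [|k [c b]]; last exact: TP.
  by split=> t; [exact: cvg_cst|rewrite normr0].
have uS k t : `|u k.+1 t - u k t| <= V * 2^-1 ^+ k.
  elim: k t => [|k IH] t.
    by rewrite expr0 mulr1 /= subr0; have [_] := uP 1%N; exact.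
  have [c1 b1] := uP k.+1; have [c0 b0] := uP k.
  have := TC _ _ _ c1 b1 c0 b0 IH t.
  by rewrite exprSr mulrA.
have /choice[f Hf] t := cW (fun k => u k t) V (uS^~ t).
have cf : continuous f.
  apply: (@uniform_geometric_continuous _ u f (2 * V)) => [k|k t].
    by case: (uP k).
  exact: Hf.
have bf t : `|f t| <= V.
  rewrite -subr_le0; apply: (@le_geometric_le0 _ (2 * V)) => k.
  have [_ /(_ t) b] := uP k; have := Hf t k; rewrite distrC.
  have := ler_normD (f t - u k t) (u k t); rewrite subrK; lra.
exists f; split => // t; apply/eqP; rewrite -subr_eq0 -normr_le0.
apply: (@le_geometric_le0 _ (2 * V)) => k.
have [c b] := uP k.
have H1 := TC f (u k) (2 * V * 2^-1 ^+ k) cf bf c b.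
have {}H1 : `|T f t - u k.+1 t| <= V * 2^-1 ^+ k.
  have -> : V * 2^-1 ^+ k = 2 * V * 2^-1 ^+ k / 2 by field.
  by apply: H1 => s; rewrite distrC; exact: Hf.
have := Hf t k.+1; rewrite exprS => H2.
have := ler_normD (T f t - u k.+1 t) (u k.+1 t - f t).
by rewrite addrA subrK; lra.
Qed.

End GeometricComplete.

(** * The system of integral equations *)

Section VolterraSystem.
Context {R : realType} {n : nat} (D : set 'rV[R]_n).
Implicit Types (q v : R -> 'rV[R]_n) (F : 'rV[R]_n * R -> 'rV[R]_n).

Lemma bdlip_comp_continuous F (z : R -> 'rV[R]_n) (s : R -> R) :
  bdlip D F -> continuous z -> continuous s ->
  (forall t, spacetime D (z t, s t)) -> continuous (fun t => F (z t, s t)).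
Proof.
move=> [M M0 [_ LF]] cz cs zs t; apply/cvgrPdist_le => e e0.
have M1 : 0 < M + 1 by rewrite ltr_wpDl.
have d0 : 0 < e / (M + 1) by exact: divr_gt0.
have /cvgrPdist_le/(_ _ d0)[d1 d10 H1] := cz t.
have /cvgrPdist_le/(_ _ d0)[d2 d20 H2] := cs t.
exists (Num.min d1 d2) => /=; first by rewrite lt_min d10.
move=> r /=; rewrite lt_min => /andP[r1 r2].
apply: le_trans (LF _ _ (zs t) (zs r)) _.
apply: (@le_trans _ _ (M * (e / (M + 1)))).
  by rewrite ler_wpM2l// pair_norm_le /= H1//= H2.
by rewrite mulrCA ler_piMr ?(ltW e0)// ler_pdivrMr// mul1r lerDl.
Qed.

Context (y0 : 'rV[R]_n) (t0 : R) (A G : 'rV[R]_n * R -> 'rV[R]_n).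
Context (B : 'I_n -> 'rV[R]_n * R -> 'rV[R]_n) (m k : R).

(** The unknowns q and v stand for the velocity of the particle and for the
derivative of its slip. Position and slip are their primitives, so the
right-hand sides below contain no derivative of the unknowns. *)
Definition position q t := y0 + primitive q t0 t.
Definition velocity_rhs q v t := primitive v t0 t + A (position q t, t).
Definition slip_rate_rhs q v t := G (position q t, t)
  - \sum_(i < n) (primitive v t0 t) 0 i *: B i (position q t, t)
  - m *: primitive v t0 t - k *: abel_integral v t0 t.

Context (M : R).
Hypotheses (t00 : 0 <= t0) (m0 : 0 <= m) (k0 : 0 <= k) (M0 : 0 <= M).

Hypotheses (AM : bdlip_by D M A) (GM : bdlip_by D M G).
Hypotheses (BM : forall i, bdlip_by D M (B i)).

Definition contraction_rate : R := 1 + M + n%:R * (2 * M) + m + 2 * k.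

Lemma ler_normB4 (W : normedModType R) (a b c d : W) :
  `|a - b - c - d| <= `|a| + `|b| + `|c| + `|d|.
Proof. by do 3 (rewrite (le_trans (ler_normB _ _))// lerD2r). Qed.

(** The interval has length s^2: the memory integral then contributes 2 s e, and
ordinary integrals at most s^2 e <= s e. In the difference of the products of
slip and field, the increment of the field is paired with the slip of
(q', v'), and this is the only slip that has to be bounded. The pair (q, v) can
therefore be any competitor of a solution with small slip. *)
Lemma rhs_contraction q v q' v' (s e : R) :
  0 <= s <= 1 ->
  continuous q -> continuous v -> continuous q' -> continuous v' ->
  (forall t, t0 <= t <= t0 + s ^+ 2 -> D (position q t)) ->
  (forall t, t0 <= t <= t0 + s ^+ 2 -> D (position q' t)) ->
  (forall t, t0 <= t <= t0 + s ^+ 2 -> `|primitive v' t0 t| <= 1) ->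
  (forall t, t0 <= t <= t0 + s ^+ 2 -> `|q t - q' t| <= e) ->
  (forall t, t0 <= t <= t0 + s ^+ 2 -> `|v t - v' t| <= e) ->
  forall t, t0 <= t <= t0 + s ^+ 2 ->
    `|velocity_rhs q v t - velocity_rhs q' v' t| <= contraction_rate * s * e /\
    `|slip_rate_rhs q v t - slip_rate_rhs q' v' t| <= contraction_rate * s * e.
Proof.
move=> /andP[s0 s1] cq cv cq' cv' Dq Dq' v'1 qe ve t tI.
have e0 : 0 <= e by apply: le_trans (qe t tI).
have [t0t tst] := andP tI.
have sub r : t0 <= r <= t -> t0 <= r <= t0 + s ^+ 2.
  by move=> /andP[-> rt]; exact: le_trans tst.
have s2s : s ^+ 2 <= s by rewrite expr2 ler_piMl.
have ts2 : t - t0 <= s ^+ 2 by rewrite lerBlDl.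
have tts : t - t0 <= s by exact: le_trans s2s.
have prim_le (f g : R -> 'rV[R]_n) : continuous f -> continuous g ->
    (forall r, t0 <= r <= t0 + s ^+ 2 -> `|f r - g r| <= e) ->
    `|primitive f t0 t - primitive g t0 t| <= s * e.
  move=> cf cg fg; rewrite -primitiveB// mulrC.
  apply: le_trans (norm_primitive_le (e := e) _ t0t _) _.
  - by move=> x; apply: cvgB; [exact: cf|exact: cg].
  - by move=> r /sub/fg.
  - by rewrite ler_wpM2l.
have dw := prim_le _ _ cv cv' ve.
have dp : `|position q t - position q' t| <= s * e.
  by rewrite /position opprD addrACA subrr add0r; exact: prim_le.
have dK : `|abel_integral v t0 t - abel_integral v' t0 t| <= 2 * s * e.
  rewrite -abel_integralB//; apply: le_trans (norm_abel_integral_le (e := e) _ t0t _) _.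
  - by move=> x; apply: cvgB; [exact: cv|exact: cv'].
  - by move=> r /sub/ve.
  - rewrite mulrC ler_wpM2r// ler_wpM2l//.
    by rewrite -[leRHS](ger0_norm s0) -sqrtr_sqr ler_wsqrtr.
have sp : spacetime D (position q t, t).
  by split => /=; [exact: Dq|rewrite in_itv/= andbT (le_trans t00)].
have sp' : spacetime D (position q' t, t).
  by split => /=; [exact: Dq'|rewrite in_itv/= andbT (le_trans t00)].
have se0 : 0 <= s * e by rewrite mulr_ge0.
have dF F : bdlip_by D M F ->
    `|F (position q t, t) - F (position q' t, t)| <= M * (s * e).
  move=> [_ LF]; apply: le_trans (LF _ _ sp sp') _; rewrite ler_wpM2l//.
  by rewrite pair_norm_le /= dp/= subrr normr0.
have Mse0 : 0 <= M * (s * e) by rewrite mulr_ge0.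
have nMse0 : 0 <= n%:R * (M * (s * e)) by rewrite mulr_ge0.
have mse0 : 0 <= m * (s * e) by rewrite mulr_ge0.
have kse0 : 0 <= k * (s * e) by rewrite mulr_ge0.
have -> : contraction_rate * s * e =
    s * e + M * (s * e) + 2 * (n%:R * (M * (s * e))) + m * (s * e)
    + 2 * (k * (s * e)) by rewrite /contraction_rate; ring.
split.
  rewrite /velocity_rhs opprD addrACA (le_trans (ler_normD _ _))//.
  by have := dF A AM; lra.
have -> : slip_rate_rhs q v t - slip_rate_rhs q' v' t =
  (G (position q t, t) - G (position q' t, t)) -
  \sum_(i < n) (
     (primitive v t0 t - primitive v' t0 t) 0 i *: B i (position q t, t) +
     primitive v' t0 t 0 i *: (B i (position q t, t) - B i (position q' t, t))) -
  m *: (primitive v t0 t - primitive v' t0 t) -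
  k *: (abel_integral v t0 t - abel_integral v' t0 t).
  have -> : \sum_(i < n) (
     (primitive v t0 t - primitive v' t0 t) 0 i *: B i (position q t, t) +
     primitive v' t0 t 0 i *: (B i (position q t, t) - B i (position q' t, t))) =
     \sum_(i < n) (primitive v t0 t) 0 i *: B i (position q t, t) -
     \sum_(i < n) (primitive v' t0 t) 0 i *: B i (position q' t, t).
    rewrite -sumrB; apply: eq_bigr => i _; apply/rowP => j; rewrite !mxE; ring.
  rewrite /slip_rate_rhs; apply/rowP => j; rewrite !mxE; ring.
have dS : `|\sum_(i < n) (
     (primitive v t0 t - primitive v' t0 t) 0 i *: B i (position q t, t) +
     primitive v' t0 t 0 i *: (B i (position q t, t) - B i (position q' t, t)))|
     <= 2 * (n%:R * (M * (s * e))).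
  apply: le_trans (ler_norm_sum _ _ _) _.
  apply: (@le_trans _ _ (\sum_(i < n) 2 * (M * (s * e)))); last first.
    by rewrite sumr_const card_ord -[leLHS]mulr_natl mulrCA.
  apply: ler_sum => i _; apply: le_trans (ler_normD _ _) _; rewrite !normrZ.
  rewrite mulr_natl mulr2n; apply: lerD.
    rewrite mulrC; apply: ler_pM => //; first by have [+ _] := BM i; apply.
    exact: le_trans (rV_coord_le _ _) dw.
  rewrite -[leRHS]mul1r; apply: ler_pM => //; last exact: dF.
  exact: le_trans (rV_coord_le _ _) (v'1 t tI).
have dG := dF G GM.
have dm : `|m *: (primitive v t0 t - primitive v' t0 t)| <= m * (s * e).
  by rewrite normrZ ger0_norm// ler_wpM2l.
have dk : `|k *: (abel_integral v t0 t - abel_integral v' t0 t)| <= 2 * (k * (s * e)).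
  rewrite normrZ ger0_norm//.
  have -> : 2 * (k * (s * e)) = k * (2 * s * e) by ring.
  by rewrite ler_wpM2l.
set g1 := G _ - G _ in dG *; set g2 := \sum_(i < n) _ in dS *.
set g3 := m *: _ in dm *; set g4 := k *: _ in dk *.
apply: le_trans (ler_normB4 _ _ _ _) _.
apply: le_trans (lerD (lerD (lerD dG dS) dm) dk) _.
by rewrite -!addrA lerDr.
Qed.

Definition rhs_bound : R := 1 + M + n%:R * M + m + k.

(** Keeping the slip and the memory integral below 1 gives a bound on the
right-hand sides that does not involve V. With V equal to this bound, the
functions bounded by V form an invariant class. *)
Lemma rhs_bounded q v (s V : R) : 0 <= s <= 1 -> 2 * s * V <= 1 ->
  continuous q -> continuous v ->
  (forall t, t0 <= t <= t0 + s ^+ 2 -> D (position q t)) ->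
  (forall t, t0 <= t <= t0 + s ^+ 2 -> `|v t| <= V) ->
  forall t, t0 <= t <= t0 + s ^+ 2 ->
    [/\ `|primitive v t0 t| <= 1, `|velocity_rhs q v t| <= rhs_bound &
        `|slip_rate_rhs q v t| <= rhs_bound].
Proof.
move=> /andP[s0 s1] sV cq cv Dq vV t tI.
have V0 : 0 <= V by apply: le_trans (vV t tI).
have [t0t tst] := andP tI.
have sub r : t0 <= r <= t -> t0 <= r <= t0 + s ^+ 2.
  by move=> /andP[-> rt]; exact: le_trans tst.
have s2s : s ^+ 2 <= s by rewrite expr2 ler_piMl.
have ts2 : t - t0 <= s ^+ 2 by rewrite lerBlDl.
have tts : t - t0 <= s by exact: le_trans s2s.
have sV0 : 0 <= s * V by rewrite mulr_ge0.
have w1 : `|primitive v t0 t| <= 1.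
  apply: le_trans (norm_primitive_le cv t0t (e := V) _) _; first by move=> r /sub/vV.
  apply: (@le_trans _ _ (V * s)); first exact: ler_wpM2l.
  have -> : V * s = s * V by ring.
  lra.
have K1 : `|abel_integral v t0 t| <= 1.
  apply: le_trans (norm_abel_integral_le cv t0t (e := V) _) _; first by move=> r /sub/vV.
  apply: le_trans sV; rewrite mulrC ler_wpM2r// ler_wpM2l//.
  by rewrite -[leRHS](ger0_norm s0) -sqrtr_sqr ler_wsqrtr.
have sp : spacetime D (position q t, t).
  by split => /=; [exact: Dq|rewrite in_itv/= andbT (le_trans t00)].
have nM0 : 0 <= n%:R * M by rewrite mulr_ge0.
have Ab := AM.1 _ sp; have Gb := GM.1 _ sp.
split => //.
  rewrite /velocity_rhs (le_trans (ler_normD _ _))//.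
  by apply: (le_trans (lerD w1 Ab)); rewrite /rhs_bound; have := m0; have := k0; lra.
have dS : `|\sum_(i < n) (primitive v t0 t) 0 i *: B i (position q t, t)| <= n%:R * M.
  apply: le_trans (ler_norm_sum _ _ _) _.
  apply: (@le_trans _ _ (\sum_(i < n) M)); last first.
    by rewrite sumr_const card_ord mulr_natl.
  apply: ler_sum => i _; rewrite normrZ -[leRHS]mul1r; apply: ler_pM => //.
    exact: le_trans (rV_coord_le _ _) w1.
  by have [+ _] := BM i; apply.
have dm : `|m *: primitive v t0 t| <= m by rewrite normrZ ger0_norm// ler_piMr.
have dk : `|k *: abel_integral v t0 t| <= k by rewrite normrZ ger0_norm// ler_piMr.
rewrite /slip_rate_rhs.
set g1 := G _ in Gb *; set g2 := \sum_(i < n) _ in dS *.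
set g3 := m *: _ in dm *; set g4 := k *: _ in dk *.
apply: le_trans (ler_normB4 _ _ _ _) _.
apply: le_trans (lerD (lerD (lerD Gb dS) dm) dk) _.
by rewrite /rhs_bound -!addrA lerDr.
Qed.

Lemma continuous_position_clamp q (s e : R) :
  continuous q -> (forall t, t0 <= t <= t0 + s ^+ 2 -> `|q t| <= e) ->
  continuous (fun t => position q (clamp t0 (t0 + s ^+ 2) t)).
Proof.
move=> cq qe t; apply: cvgD; first exact: cvg_cst.
by apply: (continuous_primitive_clamp _ cq qe); rewrite lerDl sqr_ge0.
Qed.

Lemma clamped_rhs_continuous q v (s e : R) : bdlip D A -> bdlip D G ->
  (forall i, bdlip D (B i)) ->
  continuous q -> continuous v ->
  (forall t, t0 <= t <= t0 + s ^+ 2 -> `|q t| <= e) ->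
  (forall t, t0 <= t <= t0 + s ^+ 2 -> `|v t| <= e) ->
  (forall t, t0 <= t <= t0 + s ^+ 2 -> D (position q t)) ->
  continuous (fun t => velocity_rhs q v (clamp t0 (t0 + s ^+ 2) t)) /\
  continuous (fun t => slip_rate_rhs q v (clamp t0 (t0 + s ^+ 2) t)).
Proof.
move=> bA bG bB cq cv qe ve Dq.
have I0 : t0 <= t0 + s ^+ 2 by rewrite lerDl sqr_ge0.
have cw := continuous_primitive_clamp I0 cv ve.
have cK := continuous_abel_integral_clamp I0 cv ve.
have cp := continuous_position_clamp cq qe.
have cc := @continuous_clamp R t0 (t0 + s ^+ 2).
have st t : spacetime D (position q (clamp t0 (t0 + s ^+ 2) t), clamp t0 (t0 + s ^+ 2) t).
  have cl := clampP t I0; split => /=; first exact: Dq.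
  by rewrite in_itv/= andbT (le_trans t00)//; case/andP: cl.
have cF F : bdlip D F -> continuous (fun t =>
    F (position q (clamp t0 (t0 + s ^+ 2) t), clamp t0 (t0 + s ^+ 2) t)).
  by move=> bF; exact: (bdlip_comp_continuous bF cp cc st).
split=> t; first by apply: cvgD; [exact: cw|exact: cF].
apply: cvgB; last by apply: cvgZr; exact: cK.
apply: cvgB; last by apply: cvgZr; exact: cw.
apply: cvgB; first exact: cF.
apply: (@cvg_big _ _ +%R 0 xpredT add_continuous) => i _; apply: cvgZ; last exact: cF.
exact: (continuous_coord cw).
Qed.

(** Uniqueness iterates the contraction estimate between a competitor and the
constructed solution: their distance, finite by compactness, is halved at each
step. *)
Theorem volterra_system : open D -> D y0 ->
  exists2 d : R, 0 < d & exists q v, [/\ continuous q, continuous v,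
    forall t, t0 <= t <= t0 + d ->
      [/\ D (position q t), q t = velocity_rhs q v t & v t = slip_rate_rhs q v t] &
    forall q' v', continuous q' -> continuous v' ->
      (forall t, t0 <= t <= t0 + d ->
        [/\ D (position q' t), q' t = velocity_rhs q' v' t &
            v' t = slip_rate_rhs q' v' t]) ->
      forall t, t0 <= t <= t0 + d -> q' t = q t].
Proof.
move=> oD Dy0; have [r r0 Dr] := open_radius oD Dy0.
have bA : bdlip D A by exists M.
have bG : bdlip D G by exists M.
have bB i : bdlip D (B i) by exists M => //; exact: BM.
pose C := contraction_rate; pose V := rhs_bound.
have nM0 : 0 <= n%:R * M by rewrite mulr_ge0.
have C1 : 1 <= C by rewrite /C /contraction_rate; have := m0; have := k0; have := M0; lra.
have V1 : 1 <= V by rewrite /V /rhs_bound; have := m0; have := k0; have := M0; lra.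
have V0 : 0 <= V by lra.
have Vr0 : 0 <= V / r by rewrite divr_ge0// ltW.
(* The inverse s of den must halve distances (den >= 2 C), keep slip and memory
   below 1 (den >= 2 V), and keep the trajectory in the ball of radius r
   (s V < r). *)
pose den := 2 * (C + V + V / r).
have den0 : 0 < den by rewrite /den; lra.
pose s := den^-1.
have s0 : 0 < s by rewrite invr_gt0.
have sden : s * den = 1 by rewrite mulVf// gt_eqF.
have sx x : x <= den -> s * x <= 1 by move=> xd; rewrite -sden ler_wpM2l// ltW.
have s1 : s <= 1 by rewrite -[s]mulr1; apply: sx; rewrite /den; lra.
have s01 : 0 <= s <= 1 by rewrite (ltW s0).
have sC : C * s <= 1 / 2 by have := sx (2 * C); rewrite /den; lra.
have sV : 2 * s * V <= 1.
  by rewrite mulrAC mulrC; apply: sx; rewrite /den; lra.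
have sr : s * V < r.
  have : s * (2 * (V / r)) <= 1 by apply: sx; rewrite /den; lra.
  have -> : s * (2 * (V / r)) = 2 * (s * V) / r by ring.
  by rewrite ler_pdivrMr//; lra.
pose b := t0 + s ^+ 2; have I0 : t0 <= b by rewrite lerDl sqr_ge0.
have s2s : s ^+ 2 <= s by rewrite expr2 ler_piMl// ltW.
have inD q : continuous q -> (forall t, t0 <= t <= b -> `|q t| <= V) ->
    forall t, t0 <= t <= b -> D (position q t).
  move=> cq qV t /andP[t0t tb]; apply: Dr; rewrite /position addrAC subrr add0r.
  apply: le_lt_trans sr; rewrite mulrC.
  apply: le_trans (norm_primitive_le cq t0t (e := V) _) _.
    by move=> x /andP[x0 xt]; apply: qV; rewrite x0 (le_trans xt).
  by rewrite ler_wpM2l//; apply: le_trans s2s; rewrite lerBlDl.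
pose Q (X : R -> 'rV[R]_n * 'rV[R]_n) t := (X t).1.
pose W (X : R -> 'rV[R]_n * 'rV[R]_n) t := (X t).2.
have cQ X : continuous X -> continuous (Q X).
  by move=> cX t; apply: (@continuous_comp _ _ _ X fst t (cX t)); exact: cvg_fst.
have cW X : continuous X -> continuous (W X).
  by move=> cX t; apply: (@continuous_comp _ _ _ X snd t (cX t)); exact: cvg_snd.
have QW_le X t e : `|X t| <= e -> `|Q X t| <= e /\ `|W X t| <= e.
  by rewrite prod_normE ge_max => /andP.
pose T (X : R -> 'rV[R]_n * 'rV[R]_n) t : 'rV[R]_n * 'rV[R]_n :=
  (velocity_rhs (Q X) (W X) (clamp t0 b t), slip_rate_rhs (Q X) (W X) (clamp t0 b t)).
have [X [cX XV TX]] : exists X, [/\ continuous X, forall t, `|X t| <= V &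
    forall t, T X t = X t].
  apply: picard_fixed_point => //.
  - by apply: pair_geometrically_complete; exact: rV_geometrically_complete.
  - move=> X cX XV.
    have QV t := (QW_le _ _ _ (XV t)).1; have WV t := (QW_le _ _ _ (XV t)).2.
    have Dq := inD _ (cQ _ cX) (fun t _ => QV t).
    have [c1 c2] := clamped_rhs_continuous bA bG bB (cQ _ cX) (cW _ cX)
      (fun t _ => QV t) (fun t _ => WV t) Dq.
    split=> t; first exact: (cvg_pair (c1 t) (c2 t)).
    have [_ h1 h2] := rhs_bounded s01 sV (cQ _ cX) (cW _ cX) Dq
      (fun t _ => WV t) (clampP t I0).
    by rewrite prod_normE ge_max h1 h2.
  - move=> X Y e cX XV cY YV XY t.
    have QV t := (QW_le _ _ _ (XV t)).1.
    have QV' t := (QW_le _ _ _ (YV t)).1; have WV' t := (QW_le _ _ _ (YV t)).2.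
    have Dq := inD _ (cQ _ cX) (fun t _ => QV t).
    have Dq' := inD _ (cQ _ cY) (fun t _ => QV' t).
    have e0 : 0 <= e by exact: le_trans (XY t0).
    have qe x : `|Q X x - Q Y x| <= e.
      by apply: le_trans (XY x); rewrite prod_normE le_max lexx.
    have we x : `|W X x - W Y x| <= e.
      by apply: le_trans (XY x); rewrite prod_normE le_max lexx orbT.
    have w1 x (xI : t0 <= x <= b) : `|primitive (W Y) t0 x| <= 1.
      by have [] := rhs_bounded s01 sV (cQ _ cY) (cW _ cY) Dq' (fun t _ => WV' t) xI.
    have [h1 h2] := rhs_contraction s01 (cQ _ cX) (cW _ cX) (cQ _ cY) (cW _ cY)
      Dq Dq' w1 (fun x _ => qe x) (fun x _ => we x) (clampP t I0).
    have Ce : C * s * e <= e / 2 by rewrite mulrC ler_wpM2l// -div1r.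
    by rewrite prod_normE ge_max (le_trans h1 Ce) (le_trans h2 Ce).
pose q := Q X; pose v := W X.
have cq := cQ _ cX; have cv := cW _ cX.
have QV t := (QW_le _ _ _ (XV t)).1; have WV t := (QW_le _ _ _ (XV t)).2.
have Dq := inD _ cq (fun t _ => QV t).
have eqs t : t0 <= t <= b -> q t = velocity_rhs q v t /\ v t = slip_rate_rhs q v t.
  move=> tI; have := TX t; rewrite /T (clamp_id tI).
  by rewrite [in RHS](surjective_pairing (X t)) => -[h1 h2]; split; exact: esym.
exists (s ^+ 2); first exact: exprn_gt0.
exists q, v; split; [exact: cq|exact: cv|move=> t tI|move=> q' v' cq' cv' sol'].
  by have [? ?] := eqs t tI; split=> //; exact: Dq.
have [E1 HE1] := segment_bounded t0 b (fun x => cvgB (cq' x) (cq x)).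
have [E2 HE2] := segment_bounded t0 b (fun x => cvgB (cv' x) (cv x)).
pose E := Num.max E1 E2.
have w1 x (xI : t0 <= x <= b) : `|primitive v t0 x| <= 1.
  by have [] := rhs_bounded s01 sV cq cv Dq (fun t _ => WV t) xI.
(* The constructed solution comes second: its slip is the one known to be
   below 1. *)
have H j : forall t, t0 <= t <= b ->
    `|q' t - q t| <= E * 2^-1 ^+ j /\ `|v' t - v t| <= E * 2^-1 ^+ j.
  elim: j => [|j IH] t tI.
    by rewrite expr0 mulr1 !le_max HE1// HE2// orbT.
  have [D' q't v't] := sol' t tI; have [qt vt] := eqs t tI.
  have [h1 h2] := rhs_contraction s01 cq' cv' cq cv
    (fun x xI => let: And3 Dx _ _ := sol' x xI in Dx) Dq w1
    (fun x xI => (IH x xI).1) (fun x xI => (IH x xI).2) tI.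
  have E0 : 0 <= E * 2^-1 ^+ j by exact: le_trans (normr_ge0 _) (IH t tI).1.
  have Ce : C * s * (E * 2^-1 ^+ j) <= E * 2^-1 ^+ j.+1.
    by rewrite mulrC exprSr [leRHS]mulrA ler_wpM2l// -div1r.
  by rewrite q't v't qt vt (le_trans h1 Ce) (le_trans h2 Ce).
move=> t tI; apply/eqP; rewrite -subr_eq0 -normr_le0.
by apply: (@le_geometric_le0 _ _ E) => j; case: (H j t tI).
Qed.

End VolterraSystem.

(** * Regularity of the coefficients *)

Section FieldAlgebra.
Context {R : realType} {n : nat} (D : set 'rV[R]_n).
Implicit Types (F G : 'rV[R]_n * R -> 'rV[R]_n) (p q : 'rV[R]_n * R).

Lemma eq_bdlip F G : (forall p, spacetime D p -> F p = G p) ->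
  bdlip D F -> bdlip D G.
Proof.
move=> FG [M M0 [bF lF]]; exists M => //; split=> [p sp|p q sp sq].
  by rewrite -FG// bF.
by rewrite -!FG// lF.
Qed.

Lemma bdlip_cst (c : 'rV[R]_n) : bdlip D (fun=> c).
Proof.
by exists `|c| => //; split=> // p q _ _; rewrite subrr normr0 mulr_ge0.
Qed.

Lemma bdlipD F G : bdlip D F -> bdlip D G -> bdlip D (fun p => F p + G p).
Proof.
move=> [M M0 [bF lF]] [N N0 [bG lG]]; exists (M + N); first exact: addr_ge0.
split=> [p sp|p q sp sq]; first by rewrite (le_trans (ler_normD _ _))// lerD ?bF ?bG.
rewrite opprD addrACA (le_trans (ler_normD _ _))// mulrDl.
by rewrite lerD ?lF ?lG.
Qed.

Lemma bdlipZ (c : R) F : bdlip D F -> bdlip D (fun p => c *: F p).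
Proof.
move=> [M M0 [bF lF]]; exists (`|c| * M); first exact: mulr_ge0.
split=> [p sp|p q sp sq]; first by rewrite normrZ ler_wpM2l// bF.
by rewrite -scalerBr normrZ -mulrA ler_wpM2l// lF.
Qed.

Lemma bdlipN F : bdlip D F -> bdlip D (fun p => - F p).
Proof. by move=> /(bdlipZ (-1)); apply: eq_bdlip => p _; rewrite scaleN1r. Qed.

(** The product rule for bounded Lipschitz functions, which fails for functions
that are Lipschitz but unbounded. *)
Lemma bdlip_coordZ F G (i : 'I_n) : bdlip D F -> bdlip D G ->
  bdlip D (fun p => F p 0 i *: G p).
Proof.
move=> [M M0 [bF lF]] [N N0 [bG lG]]; exists (M * N + M * N).
  by rewrite addr_ge0// mulr_ge0.
split=> [p sp|p q sp sq].
  apply: (@le_trans _ _ (M * N)); last by rewrite lerDl mulr_ge0.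
  by rewrite normrZ ler_pM ?bG// (le_trans (rV_coord_le _ _))// bF.
have -> : F p 0 i *: G p - F q 0 i *: G q =
    (F p - F q) 0 i *: G p + F q 0 i *: (G p - G q).
  by apply/rowP => j; rewrite !mxE; ring.
apply: le_trans (ler_normD _ _) _; rewrite mulrDl; apply: lerD; rewrite normrZ.
  rewrite mulrAC; apply: ler_pM => //; last exact: bG.
  exact: le_trans (rV_coord_le _ _) (lF _ _ sp sq).
rewrite -mulrA; apply: ler_pM => //; last exact: lG.
exact: le_trans (rV_coord_le _ _) (bF _ sq).
Qed.

Lemma bdlip_sum (I : Type) (r : seq I) (F : I -> 'rV[R]_n * R -> 'rV[R]_n) :
  (forall i, bdlip D (F i)) -> bdlip D (fun p => \sum_(i <- r) F i p).
Proof.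
move=> H; elim: r => [|i r IH].
  by apply: eq_bdlip (bdlip_cst 0) => p _; rewrite big_nil.
by apply: eq_bdlip (bdlipD (H i) IH) => p _; rewrite big_cons.
Qed.

Lemma bdlip_derive_along F G : smooth_field D F -> bdlip D G ->
  bdlip D (fun p => derive_along D F (G p) p).
Proof.
move=> [_ _ dF] bG; apply: bdlipD => //; apply: bdlip_sum => i.
exact: bdlip_coordZ.
Qed.

Lemma derive_alongD F (w a : 'rV[R]_n) p :
  derive_along D F (w + a) p =
  derive_along D F a p + \sum_(i < n) w 0 i *: partial D (Some i) F p.
Proof.
rewrite /derive_along -addrA -big_split/=; congr (_ + _); apply: eq_bigr => i _.
by rewrite -scalerDl mxE addrC.
Qed.

Lemma common_bound (F G : 'rV[R]_n * R -> 'rV[R]_n)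
    (B : 'I_n -> 'rV[R]_n * R -> 'rV[R]_n) :
  bdlip D F -> bdlip D G -> (forall i, bdlip D (B i)) ->
  exists2 M, 0 <= M &
    [/\ bdlip_by D M F, bdlip_by D M G & forall i, bdlip_by D M (B i)].
Proof.
move=> [M M0 HF] [N N0 HG] /bdlip_family[K K0 HB].
exists (M + N + K); first by rewrite !addr_ge0.
by split=> [||i]; [apply: bdlip_by_le HF|apply: bdlip_by_le HG|
  apply: bdlip_by_le (HB i)]; lra.
Qed.

End FieldAlgebra.

Section FlowRegularity.
Context {R : realType} {n : nat} (D : set 'rV[R]_n).
Context (u : 'rV[R]_n * R -> 'rV[R]_n).
Hypotheses (oD : open D) (hu : H1 D u).

Lemma H1_bdlip (s : seq (option 'I_n)) : (size s <= 3)%N -> bdlip D (partials D s u).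
Proof.
move=> s3; have [_ [M [_ bM]] [N [_ lN]]] := hu.2 s s3.
exists (`|M| + `|N| + 1); first by rewrite !addr_ge0.
have M1 : M < `|M| + `|N| + 1 by have := ler_norm M; have := normr_ge0 N; lra.
have N1 : N < `|M| + `|N| + 1 by have := ler_norm N; have := normr_ge0 M; lra.
split=> [p sp|p q sp sq]; first exact: (bM _ M1).
exact: (lN _ N1 (p, q)).
Qed.

Lemma H1_is_derive_within (s : seq (option 'I_n)) k p :
  (size s < 3)%N -> spacetime D p ->
  is_derive_within (spacetime D) (partials D s u) p (axis k) (partials D (k :: s) u p).
Proof. by move=> s3 sp; apply: derivable_is_derive_within; exact: hu.1. Qed.

Definition flow_blend (a b : R) : 'rV[R]_n * R -> 'rV[R]_n :=
  fun p => a *: u p + b *: laplacian D u p.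

(** One derivative of the Laplacian produces the derivatives of order three of
u, the last ones that (H1) controls. The coefficients a and b distinguish the
two combinations of u and its Laplacian in the equation of motion. *)
Lemma smooth_flow_blend a b : smooth_field D (flow_blend a b).
Proof.
have dw k p : spacetime D p ->
      is_derive_within (spacetime D) (flow_blend a b) p (axis k)
    (a *: partials D [:: k] u p +
     b *: \sum_(i < n) partials D [:: k; Some i; Some i] u p).
  move=> sp; apply: is_derive_withinD; apply: is_derive_withinZ.
    exact: (@H1_is_derive_within [::]).
  apply: (@is_derive_within_sum _ _ _ _ _ _ (fun i => partials D [:: Some i; Some i] u)
    (fun i => partials D [:: k; Some i; Some i] u p)) => i.
  exact: H1_is_derive_within.
split=> [k p sp||k].
- exact: is_derive_within_derivable (dw k p sp).
- apply: bdlipD; apply: bdlipZ; first exact: (@H1_bdlip [::]).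
  by apply: bdlip_sum => i; exact: H1_bdlip.
- apply: (@eq_bdlip _ _ _ (fun p => a *: partials D [:: k] u p +
     b *: \sum_(i < n) partials D [:: k; Some i; Some i] u p)) => [p sp|].
    rewrite /partial (is_derive_within_val _ (dw k p sp))//.
    exact: accessible_spacetime.
  apply: bdlipD; apply: bdlipZ; [exact: H1_bdlip|].
  by apply: bdlip_sum => i; exact: H1_bdlip.
Qed.

End FlowRegularity.

(** * From the equation of motion to the integral equations *)

Section Reduction.
Context {R : realType} {n : nat} (P : physics R n) (D : set 'rV[R]_n).
Context (u : 'rV[R]_n * R -> 'rV[R]_n) (t0 : R).
Hypotheses (oD : open D) (hu : H1 D u) (t00 : 0 <= t0).

(** The fluid velocity with the Faxen correction; the slip is measured against
it. *)
Definition faxen_velocity : 'rV[R]_n * R -> 'rV[R]_n :=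
  flow_blend D u 1 (gamma P / 6 * (mu P)^-1).

(** The derivative of the slip of a particle that has neither slip nor memory:
the material acceleration and the buoyancy, minus the rate of change of the
Faxen velocity along a path that follows it. *)
Definition slip_forcing : 'rV[R]_n * R -> 'rV[R]_n := fun p =>
  (density_ratio P / 2) *:
    material D u (flow_blend D u 3 (gamma P / 10 * (mu P)^-1)) p
  + (1 - 3 * density_ratio P / 2) *: gravity P
  - derive_along D faxen_velocity (faxen_velocity p) p.

Lemma smooth_faxen_velocity : smooth_field D faxen_velocity.
Proof. exact: smooth_flow_blend. Qed.

Lemma bdlip_slip_forcing : bdlip D slip_forcing.
Proof.
apply: bdlipD; last first.
  apply: bdlipN; apply: bdlip_derive_along; first exact: smooth_faxen_velocity.
  by case: smooth_faxen_velocity.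
apply: bdlipD; last exact: bdlip_cst.
apply: bdlipZ; apply: (@bdlip_derive_along _ _ _ _ u).
  exact: smooth_flow_blend.
exact: (H1_bdlip hu (s := [::])).
Qed.

Lemma relvelE d y t :
  relvel P D u t0 d y t = dot t0 d y t - faxen_velocity (y t, t).
Proof. by rewrite /relvel /faxen_velocity /flow_blend scale1r opprD addrA. Qed.

Lemma memoryE d y t : relvel P D u t0 d y t0 = 0 ->
  memory P D u t0 d y t = abel_integral (dot t0 d (relvel P D u t0 d y)) t0 t.
Proof. by move=> w0; rewrite /memory w0 scaler0 addr0. Qed.

Let slip_rhs q v y0 t := slip_rate_rhs y0 t0 slip_forcing
  (fun i => partial D (Some i) faxen_velocity) (mu P) (kappa P * Num.sqrt (mu P)) q v t.

(** Since q = w + A, the derivative of A along the particle path splits into its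
derivative along a path with velocity A, which belongs to [slip_forcing], and
the sum of the w_i dA/dx_i, which is the middle term of the slip equation. *)
Lemma acceleration_balance (q v : R -> 'rV[R]_n) y0 t (z m : 'rV[R]_n) :
  position y0 t0 q t = z -> abel_integral v t0 t = m ->
  q t = velocity_rhs y0 t0 faxen_velocity q v t ->
  (v t = slip_rhs q v y0 t <->
   v t + derive_along D faxen_velocity (q t) (z, t) =
   (density_ratio P / 2) *:
      material D u (flow_blend D u 3 (gamma P / 10 * (mu P)^-1)) (z, t)
    + (1 - 3 * density_ratio P / 2) *: gravity P
    - mu P *: (q t - u (z, t) - (gamma P / 6 * (mu P)^-1) *: laplacian D u (z, t))
    - (kappa P * Num.sqrt (mu P)) *: m).
Proof.
move=> zE mE qE.
have -> : q t - u (z, t) - (gamma P / 6 * (mu P)^-1) *: laplacian D u (z, t)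
    = primitive v t0 t.
  rewrite -addrA -opprD qE /velocity_rhs zE /faxen_velocity /flow_blend scale1r.
  by rewrite addrK.
rewrite qE /velocity_rhs zE derive_alongD /slip_rhs /slip_rate_rhs zE mE /slip_forcing.
set M := _ *: material _ _ _ _; set S := \sum_(i < n) _; set g := _ *: gravity _.
set a := mu P *: _; set b := _ *: m; set c := derive_along _ _ _ _.
clearbody M S g a b c.
have -> : M + g - c - S - a - b = (M + g - a - b) - (c + S).
  by apply/rowP => j; rewrite !mxE; ring.
by split=> [->|<-]; rewrite ?subrK ?addrK.
Qed.

Lemma dot_is_derive_within d (z l : R -> 'rV[R]_n) t : 0 < d -> t0 <= t <= t0 + d ->
  is_derive_within `[t0, t0 + d] z t 1 (l t) -> dot t0 d z t = l t.
Proof.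
move=> d0 tI; apply: is_derive_within_val; apply: accessible_segment => //.
by rewrite ltrDl.
Qed.

Lemma C1_is_derive_within d (z : R -> 'rV[R]_n) t : C1 t0 d z -> t0 <= t <= t0 + d ->
  is_derive_within `[t0, t0 + d] z t 1 (dot t0 d z t).
Proof. by move=> [dz _] tI; apply/derivable_is_derive_within/dz; rewrite in_itv. Qed.

Lemma is_derive_within_C1 d (z l : R -> 'rV[R]_n) : 0 < d -> continuous l ->
  (forall t, t0 <= t <= t0 + d ->
     is_derive_within `[t0, t0 + d] z t 1 (l t)) -> C1 t0 d z.
Proof.
move=> d0 cl zl; split=> [t|].
  by rewrite in_itv/= => /zl/is_derive_within_derivable.
by apply: eq_within_continuous cl _ => t tI; apply: dot_is_derive_within => //; exact: zl.
Qed.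

(** The slip relation y' = w + A(y, t) is the first integral equation as it
stands. Differentiated by the chain rule and compared with the equation of
motion, it gives the second one. *)
Lemma solution_system d y0 y : 0 < d -> strong_solution P D u t0 d y ->
  y t0 = y0 -> relvel P D u t0 d y t0 = 0 ->
  exists q v, [/\ continuous q, continuous v &
    forall t, t0 <= t <= t0 + d -> [/\ y t = position y0 t0 q t, D (position y0 t0 q t),
      q t = velocity_rhs y0 t0 faxen_velocity q v t & v t = slip_rhs q v y0 t]].
Proof.
move=> d0 [C1y C1dy C1w MR] yt0 w0.
have ab : t0 <= t0 + d by rewrite lerDl ltW.
have t0I : t0 <= t0 <= t0 + d by rewrite lexx.
pose w := relvel P D u t0 d y.
pose q := dot t0 d y \o clamp t0 (t0 + d); pose v := dot t0 d w \o clamp t0 (t0 + d).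
have cq : continuous q by exact: within_continuous_clamp ab C1y.2.
have cv : continuous v by exact: within_continuous_clamp ab C1w.2.
have qE t : t0 <= t <= t0 + d -> q t = dot t0 d y t.
  by move=> tI; rewrite /q /= clamp_id.
have vE t : t0 <= t <= t0 + d -> v t = dot t0 d w t.
  by move=> tI; rewrite /v /= clamp_id.
clearbody q v.
have dy t : t0 <= t <= t0 + d -> is_derive_within `[t0, t0 + d] y t 1 (q t).
  by move=> tI; rewrite qE//; exact: C1_is_derive_within.
have dw t : t0 <= t <= t0 + d -> is_derive_within `[t0, t0 + d] w t 1 (v t).
  by move=> tI; rewrite vE//; exact: C1_is_derive_within.
have yE t : t0 <= t <= t0 + d -> y t = position y0 t0 q t.
  by move=> tI; rewrite (is_derive_within_primitive_eq ab cq dy tI) yt0.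
have wE t : t0 <= t <= t0 + d -> w t = primitive v t0 t.
  by move=> tI; rewrite (is_derive_within_primitive_eq ab cv dw tI) /w w0 add0r.
have Dy t : t0 <= t <= t0 + d -> D (y t).
  by move=> tI; have [] := MR t; rewrite ?in_itv.
have r1 t : t0 <= t <= t0 + d -> q t = velocity_rhs y0 t0 faxen_velocity q v t.
  by move=> tI; rewrite /velocity_rhs -yE// -wE// qE// /w relvelE subrK.
exists q, v; split=> // t tI; split; [exact: yE|by rewrite -yE//; exact: Dy|exact: r1|].
have vt : abel_integral v t0 t = memory P D u t0 d y t.
  rewrite (memoryE _ w0).
  apply: (@eq_abel_integral _ _ v (dot t0 d w) t0 t) => s /andP[t0s st].
  by apply: vE; rewrite t0s (le_trans st)//; case/andP: tI.
apply/(acceleration_balance (esym (yE t tI)) vt (r1 t tI)).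
have [_] : D (y t) /\ maxey_riley_at P D u t0 d y t by apply: MR; rewrite in_itv.
rewrite /maxey_riley_at -qE// => <-; apply/esym.
apply: (@dot_is_derive_within _ _ (fun t =>
  v t + derive_along D faxen_velocity (q t) (y t, t))) => //.
apply: (@eq_is_derive_within _ _ _ _ (fun s => w s + faxen_velocity (y s, s))).
- by rewrite /= in_itv.
- by move=> s _; rewrite /w relvelE subrK.
- apply: is_derive_withinD; first exact: dw.
  exact: (is_derive_within_field oD smooth_faxen_velocity t00 tI Dy (dy t tI)).
Qed.

(** The velocity q is differentiable although it is obtained only as a
continuous function: it is the sum of the primitive of v and of A along a
differentiable curve. *)
Lemma system_solution d y0 q v : 0 < d -> continuous q -> continuous v ->
  (forall t, t0 <= t <= t0 + d -> [/\ D (position y0 t0 q t),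
      q t = velocity_rhs y0 t0 faxen_velocity q v t & v t = slip_rhs q v y0 t]) ->
  [/\ strong_solution P D u t0 d (position y0 t0 q), position y0 t0 q t0 = y0 &
    relvel P D u t0 d (position y0 t0 q) t0 = 0].
Proof.
move=> d0 cq cv S.
have ab : t0 <= t0 + d by rewrite lerDl ltW.
have t0I : t0 <= t0 <= t0 + d by rewrite lexx.
pose y := position y0 t0 q; pose w := relvel P D u t0 d y.
have Dy t : t0 <= t <= t0 + d -> D (y t) by move=> /S[].
have dy t : t0 <= t <= t0 + d -> is_derive_within `[t0, t0 + d] y t 1 (q t).
  move=> tI; rewrite -[q t]add0r; apply: is_derive_withinD.
    exact: is_derive_within_cst.
  exact: is_derive_within_primitive.
have yE t : t0 <= t <= t0 + d -> dot t0 d y t = q t.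
  by move=> tI; apply: dot_is_derive_within => //; exact: dy.
have wE t : t0 <= t <= t0 + d -> w t = primitive v t0 t.
  move=> tI; rewrite /w relvelE yE//; have [_ -> _] := S t tI.
  by rewrite /velocity_rhs addrK.
have inI t : `[t0, t0 + d]%classic t -> t0 <= t <= t0 + d by rewrite /= in_itv.
have dw t : t0 <= t <= t0 + d -> is_derive_within `[t0, t0 + d] w t 1 (v t).
  move=> tI; apply: (@eq_is_derive_within _ _ _ _ (primitive v t0)).
    by rewrite /= in_itv.
    by move=> s /inI sI; rewrite wE.
  exact: is_derive_within_primitive.
have ddy t : t0 <= t <= t0 + d -> is_derive_within `[t0, t0 + d] (dot t0 d y) t 1
    (v t + derive_along D faxen_velocity (q t) (y t, t)).
  move=> tI.
  apply: (@eq_is_derive_within _ _ _ _ (fun s => w s + faxen_velocity (y s, s))).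
  - by rewrite /= in_itv.
  - by move=> s _; rewrite /w relvelE subrK.
  - apply: is_derive_withinD; first exact: dw.
    exact: (is_derive_within_field oD smooth_faxen_velocity t00 tI Dy (dy t tI)).
have w0 : w t0 = 0 by rewrite wE// primitivexx.
split=> //; last by rewrite /position primitivexx addr0.
pose c := clamp t0 (t0 + d).
split.
- exact: is_derive_within_C1 d0 cq dy.
- pose l t := v t + (partial D None faxen_velocity (y (c t), c t) +
    \sum_(i < n) q t 0 i *: partial D (Some i) faxen_velocity (y (c t), c t)).
  apply: (@is_derive_within_C1 _ _ l d0); last first.
    by move=> t tI; have := ddy t tI; rewrite /l /c clamp_id.
  have [E HE] := segment_bounded t0 (t0 + d) cq.
  have cy : continuous (fun t => y (c t)).
    by move=> t; apply: cvgD; [exact: cvg_cst|exact: (continuous_primitive_clamp ab cq HE)].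
  have st t : spacetime D (y (c t), c t).
    have cl := clampP t ab; split => /=; first exact: Dy.
    by rewrite in_itv/= andbT (le_trans t00)//; case/andP: cl.
  have cF k : continuous (fun t => partial D k faxen_velocity (y (c t), c t)).
    apply: bdlip_comp_continuous => //; last exact: continuous_clamp.
    by case: smooth_faxen_velocity.
  move=> t; apply: cvgD; first exact: cv.
  apply: cvgD; first exact: cF.
  apply: (@cvg_big _ _ +%R 0 xpredT add_continuous) => i _; apply: cvgZ; last exact: cF.
  exact: (continuous_coord cq).
- exact: is_derive_within_C1 d0 cv dw.
- move=> t; rewrite in_itv/= => tI; split; first exact: Dy.
  have [_ r1 r2] := S t tI.
  have vt : abel_integral v t0 t = memory P D u t0 d y t.
    rewrite (memoryE _ w0).
    apply: (@eq_abel_integral _ _ v (dot t0 d w) t0 t) => s /andP[t0s st].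
    apply/esym/dot_is_derive_within => //; last apply: dw;
      by rewrite t0s (le_trans st)//; case/andP: tI.
  rewrite /maxey_riley_at yE//.
  move/(acceleration_balance (erefl _) vt r1) : r2 => <-.
  apply: (@dot_is_derive_within _ _ (fun t =>
    v t + derive_along D faxen_velocity (q t) (y t, t))) => //.
  exact: ddy.
Qed.

End Reduction.

Theorem theorem2 (R : realType) (n : nat) (hn : n = 2%N \/ n = 3%N)
    (D : set 'rV[R]_n) (hD : open D)
    (P : physics R n)
    (hrhof : 0 < rho_f P) (hrhop : 0 < rho_p P)
    (hSt : 0 < stokes P) (hRe : 0 < reynolds P)
    (t0 : R) (ht0 : 0 <= t0)
    (u : 'rV[R]_n * R -> 'rV[R]_n) (hu : H1 D u)
    (y0 : 'rV[R]_n) (hy0 : D y0) :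
  exists2 delta : R, 0 < delta &
    let solution (y : R -> 'rV[R]_n) :=
      [/\ strong_solution P D u t0 delta y, y t0 = y0 &
          relvel P D u t0 delta y t0 = 0] in
    (exists y, solution y) /\
    (forall y z, solution y -> solution z ->
       forall t, t \in `[t0, t0 + delta] -> y t = z t).
Proof.
have [_ bA dA] := smooth_faxen_velocity P hD hu.
have [M M0 [AM GM BM]] :=
  common_bound bA (bdlip_slip_forcing P hD hu) (fun i => dA (Some i)).
have mu0 : 0 <= mu P.
  by rewrite /mu /density_ratio !(divr_ge0, addr_ge0, mulr_ge0)// ltW.
have k0 : 0 <= kappa P * Num.sqrt (mu P) by rewrite mulr_ge0 ?sqrtr_ge0.
have [d d0 [q [v [cq cv S U]]]] :=
  volterra_system ht0 mu0 k0 M0 AM GM BM hD hy0.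
exists d => //= ; split.
  by exists (position y0 t0 q); exact: (system_solution hD hu ht0 d0 cq cv S).
have uniq y : [/\ strong_solution P D u t0 d y, y t0 = y0 &
    relvel P D u t0 d y t0 = 0] ->
    forall t, t0 <= t <= t0 + d -> y t = position y0 t0 q t.
  move=> [sy yt0 w0] t tI.
  have [q' [v' [cq' cv' S']]] := solution_system hD hu ht0 d0 sy yt0 w0.
  have S'' s : t0 <= s <= t0 + d -> _ := fun sI => let: And4 _ a b c := S' s sI in And3 a b c.
  have [-> _ _ _] := S' t tI; rewrite /position; congr (_ + _).
  apply: eq_primitive => s /andP[t0s st]; apply: (U q' v' cq' cv' S'').
  by rewrite t0s (le_trans st)//; case/andP: tI.
move=> y z sy sz t; rewrite in_itv/= => tI.
by rewrite (uniq y)// (uniq z).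
Qed.
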